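(* Let $(X,\pi)$ be a holomorphic Poisson manifold of complex dimension $n$. The morphism of complexes of sheaves (commuting with the differentials up to the signs described in the context) given by contraction $$\tau:\mathfrak{X}_X^k\otimes_{\mathcal{O}_X}\Omega_X^n\to\Omega_X^{n-k},\qquad V\otimes\alpha\mapsto i_V\alpha,$$ induces, for every $k$, an isomorphism $$H^k\big(X,\pi;\wedge^nT^*X\big)\xrightarrow{\ \cong\ }H_{2n-k}(X,\pi)$$ from the Lichnerowicz-Poisson cohomology of $(X,\pi)$ with coefficients in the module $\wedge^nT^*X$ to the Koszul-Brylinski homology of $(X,\pi)$.
   Context: A holomorphic Poisson manifold $(X,\pi)$ is a complex manifold $X$ of dimension $n$ with a holomorphic bivector field $\pi$ with $[\pi,\pi]=0$; equivalently $\{f,g\}=\pi(\partial f,\partial g)$ makes the sheaf $\mathcal{O}_X$ of holomorphic functions a sheaf of Poisson algebras. $\mathfrak{X}_X^k$ and $\Omega_X^k$ are the sheaves of holomorphic sections of $\wedge^kTX$ and $\wedge^kT^*X$ (holomorphic tangent and cotangent bundles). $X_f=\{f,\cdot\}$ is the Hamiltonian vector field of $f$, and $\pi^\sharp$ is defined by $\langle\pi^\sharp\alpha,\beta\rangle=\pi(\alpha,\beta)$. Contraction by multivectors is normalized by $i_{V\wedge W}=i_W\circ i_V$. Koszul-Brylinski homology: $\partial_\pi=i_\pi\partial-\partial i_\pi:\Omega_X^k\to\Omega_X^{k-1}$, where $\partial$ is the holomorphic exterior differential. $H_*(X,\pi)$ is the hypercohomology of the complex of sheaves $\cdots\to\Omega_X^{k+1}\xrightarrow{\partial_\pi}\Omega_X^k\xrightarrow{\partial_\pi}\Omega_X^{k-1}\to\cdots$.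 Grading: placing $\Omega_X^{n-k}$ in cohomological degree $k$, $H_{2n-m}(X,\pi)$ is the $m$-th hypercohomology group (so for $\pi=0$, $H_k(X,\pi)\cong\bigoplus_{j-i=n-k}H^j(X,\Omega_X^i)$). Cotangent Lie algebroid: $(T^*X)_\pi$ is the holomorphic Lie algebroid $T^*X$ with anchor $\pi^\sharp$ and bracket on $\Omega_X^1$ given by $[\alpha,\beta]=L_{\pi^\sharp\alpha}\beta-L_{\pi^\sharp\beta}\alpha-\partial(\pi(\alpha,\beta))$. A module over it is a holomorphic vector bundle $E$, with sheaf of holomorphic sections $\mathcal{E}$, and a flat $(T^*X)_\pi$-connection $\nabla:\Omega_X^1\otimes\mathcal{E}\to\mathcal{E}$, that is, $\nabla_{f\alpha}s=f\nabla_\alpha s$, $\nabla_\alpha(fs)=(\pi^\sharp(\alpha)f)s+f\nabla_\alpha s$ and $\nabla_\alpha\nabla_\beta s-\nabla_\beta\nabla_\alpha s=\nabla_{[\alpha,\beta]}s$. $H^*(X,\pi;E)$ is the hypercohomology of the complex $\cdots\to\mathfrak{X}_X^k\otimes_{\mathcal{O}_X}\mathcal{E}\xrightarrow{d_\pi^\nabla}\mathfrak{X}_X^{k+1}\otimes_{\mathcal{O}_X}\mathcal{E}\to\cdots$, with the $k$-th term in degree $k$, where $d_\pi^\nabla$ is the Lie algebroid (Cartan formula) differential of $(T^*X)_\pi$ with coefficients in $E$. The bundle $\wedge^nT^*X$ is a $(T^*X)_\pi$-module with representation determined by $\nabla_{df}\omega=L_{X_f}\omega$ for $f\in\mathcal{O}_X$,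 $\omega\in\Omega_X^n$. The map $\tau$ intertwines $d_\pi^\nabla$ on $\mathfrak{X}_X^k\otimes_{\mathcal{O}_X}\Omega_X^n$ with $(-1)^{k+1}\partial_\pi$ on $\Omega_X^{n-k}$; the complexes with differentials $\partial_\pi$ and $(-1)^{k+1}\partial_\pi$ are identified up to signs and have the same hypercohomology. *)

(* Defs.v *)
From HB Require Import structures.
From mathcomp Require Import all_boot all_order all_algebra ring_quotient.
From mathcomp Require Import all_classical all_reals all_analysis.
From mathcomp Require Import complex.

Set Implicit Arguments.
Unset Strict Implicit.
Unset Printing Implicit Defensive.

Import Order.TTheory GRing.Theory Num.Theory numFieldNormedType.Exports.

Local Open Scope classical_set_scope.
Local Open Scope ring_scope.
Local Open Scope quotient_scope.

Definition rem_at (T : Type) (p : nat) (s : seq T) : seq T :=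
  take p s ++ drop p.+1 s.

(* A Z-graded family of sheaves of K-modules over X, each given as a subsheaf
   of the sheaf of all V-valued functions, with operators of degree 1 between
   them.  A section over U is represented by a function on the whole of X, of
   which only the values on U matter.
   It is a complex of sheaves when [dif] maps sections to sections and squares
   to zero; these two facts are not needed to define its hypercohomology. *)
Record sheaf_complex (K : fieldType) (X : topologicalType) (V : lmodType K) :=
  SheafComplex {
  sec : int -> set X -> set (X -> V);
  dif : int -> (X -> V) -> X -> V;
  sec_loc : forall q U f, open U ->
    sec q U f <-> (forall x, U x -> exists W, [/\ open W, W x & sec q W f]);
  sec_ext : forall q U f g, open U -> {in U, f =1 g} -> sec q U f -> sec q U g;
  sec_zero : forall q U, sec q U 0;
  sec_lin : forall q U a f g, sec q U f -> sec q U g -> sec q U (a *: f + g);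
  dif_loc : forall q U f g, open U ->
    {in U, f =1 g} -> {in U, dif q f =1 dif q g};
  dif_lin : forall q U a f g, open U -> sec q U f -> sec q U g ->
    {in U, dif q (a *: f + g) =1 a *: dif q f + dif q g}
}.

Section Hypercohomology.
Context {K : fieldType} {X : topologicalType} {V : lmodType K}.
Variable F : sheaf_complex X V.

(* Hypercohomology is computed by the canonical (Godement) flasque resolution
   F -> G F -> G (G F) -> ..., where (G F)(U) is the product of the stalks F_x
   for x in U.  A global section of G^(p+1) F is a family of germs c(x0, ..., xp)
   of F at xp, for x0 in X, x1 near x0, ..., xp near x(p-1), two families being
   identified when they agree for all x0, all x1 close enough to x0, all x2
   close enough to x1, etc.  The differential of the resolution is the
   alternating sum of the deletions of one point, the section c(x0, ..., xp)
   inducing a germ at x(p+1) when x(p+1) is near xp.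
   A total cochain of degree m takes a word of p + 1 points to a germ of the
   sheaf of degree m - p, represented by a function on X. *)
Definition hcochain := seq X -> X -> V.
HB.instance Definition _ := GRing.Lmodule.on hcochain.

Definition hvalid (m : int) (c : hcochain) : Prop :=
  c [::] = 0 /\
  forall (x : X) (w : seq X), exists U : set X,
    [/\ open U, U (last x w) & sec F (m - (size w)%:Z) U (c (x :: w))].

Fixpoint hvanish (p : nat) (c : hcochain) (x : X) : Prop :=
  if p is p'.+1 then
    \forall y \near x, hvanish p' (fun w => c (x :: w)) y
  else \forall z \near x, c [:: x] z = 0.

Definition hnull (c : hcochain) : Prop := forall p x, hvanish p c x.

(* The total differential, delta + (-1)^p dif on words of p + 1 points; in
   degree p = 0 the first term is 0 since c [::] = 0. *)
Definition hdif (m : int) (c : hcochain) : hcochain := fun w =>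
  \sum_(p < size w) (-1) ^+ p *: c (rem_at p w) +
  (-1) ^+ (size w).-1 *: dif F (m - ((size w).-1)%:Z) (c w).

Definition hcocycle (m : int) (c : hcochain) : Prop :=
  hvalid m c /\ hnull (hdif m c).

Definition hcobord (m : int) (c : hcochain) : Prop :=
  exists2 b, hvalid (m - 1) b & hnull (c - hdif (m - 1) b).

Definition hcocycleb (m : int) : {pred hcochain} := fun c => `[< hcocycle m c >].

Lemma hvalid_lin m a b c : hvalid m b -> hvalid m c -> hvalid m (a *: b + c).
Proof.
move=> [b0 bP] [c0 cP]; split.
  by rewrite [LHS](_ : _ = a *: b [::] + c [::]) // b0 c0 scaler0 addr0.
move=> x w; have [U [Uo Ux bU]] := bP x w; have [W [Wo Wx cW]] := cP x w.
have UWo : open (U `&` W) by exact: openI.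
exists (U `&` W); split => //.
apply: (@sec_lin _ _ _ F _ _ a (b (x :: w)) (c (x :: w))).
  apply/(sec_loc F _ _ UWo) => y [Uy Wy].
  by exists U.
apply/(sec_loc F _ _ UWo) => y [Uy Wy].
by exists W.
Qed.

Lemma hvanish_lin a b c d p x :
  (forall w y, \forall z \near y,
     d (rcons w y) z = a *: b (rcons w y) z + c (rcons w y) z) ->
  hvanish p b x -> hvanish p c x -> hvanish p d x.
Proof.
elim: p x b c d => [|p IH] x b c d lin /= bx cx.
  near=> z; have -> : d [:: x] z = a *: b [:: x] z + c [:: x] z.
    by near: z; exact: (lin [::] x).
  have -> : b [:: x] z = 0 by near: z.
  have -> : c [:: x] z = 0 by near: z.
  by rewrite scaler0 addr0.
near=> y; apply: (IH _ (fun w => b (x :: w)) (fun w => c (x :: w))).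
- by move=> w y'; exact: (lin (x :: w) y').
- by near: y.
- by near: y.
Unshelve. all: by end_near. Qed.

Lemma hdif_lin m a b c w y : hvalid m b -> hvalid m c ->
  \forall z \near y, hdif m (a *: b + c) (rcons w y) z =
    a *: hdif m b (rcons w y) z + hdif m c (rcons w y) z.
Proof.
move=> [_ bP] [_ cP].
have [x [w' [wE yE]]] : exists x w', rcons w y = x :: w' /\ y = last x w'.
  by case: w => [|x w]; [exists y, [::] | exists x, (rcons w y); rewrite last_rcons].
rewrite wE; have [U [Uo Ux bU]] := bP x w'; have [W [Wo Wx cW]] := cP x w'.
have UWo : open (U `&` W) by exact: openI.
have : \forall z \near y, (U `&` W) z.
  by apply: open_nbhs_nbhs; split => //; rewrite yE.
apply: filterS => z UWz; rewrite /hdif.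
have bUW : sec F (m - (size w')%:Z) (U `&` W) (b (x :: w')).
  by apply/(sec_loc F _ _ UWo) => u [Uu _]; exists U.
have cUW : sec F (m - (size w')%:Z) (U `&` W) (c (x :: w')).
  by apply/(sec_loc F _ _ UWo) => u [_ Wu]; exists W.
have := @dif_lin _ _ _ F _ _ a _ _ UWo bUW cUW z.
rewrite inE => /(_ UWz) E.
have fE (f g : X -> V) : (f + g) z = f z + g z by [].
have sE (k : K) (f : X -> V) : (k *: f) z = k *: f z by [].
have sumE k (f : 'I_k -> X -> V) : (\sum_(p < k) f p) z = \sum_(p < k) f p z.
  by elim/big_ind2 : _ => // ? ? ? ? <- <-.
rewrite !fE !sE [X in _ + (_ *: X) = _]E !fE !sE !sumE !scalerDr.
rewrite addrACA; congr (_ + _); last by rewrite scalerA mulrC -scalerA.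
rewrite scaler_sumr -big_split; apply: eq_bigr => p _ /=.
rewrite !sE [X in _ *: X = _](_ : _ =
  a *: b (rem_at p (x :: w')) z + c (rem_at p (x :: w')) z) //.
by rewrite scalerDr scalerA mulrC -scalerA.
Qed.

Lemma hnull0 : hnull 0.
Proof.
move=> p; have E (q : nat) (x : X) : hvanish q (fun=> fun=> 0 : V) x.
  elim: q x => [|q IH] x /=; first by near=> z.
  by near=> y; exact: IH.
exact: (E p).
Unshelve. all: by end_near. Qed.

Lemma hvalid0 m : hvalid m 0.
Proof.
split=> // x w; exists setT; split => //; first exact: openT.
exact: sec_zero.
Qed.

Lemma hnull_near c :
  (forall w y, \forall z \near y, c (rcons w y) z = 0) -> hnull c.
Proof.
move=> c0 p x; apply: (@hvanish_lin 0 0 0); try exact: hnull0.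
move=> w y; apply: filterS (c0 w y) => z ->.
by rewrite scale0r add0r.
Qed.

Lemma hdif0 m : hnull (hdif m 0).
Proof.
apply: hnull_near => w y.
have := @hdif_lin m (-1) 0 0 w y (hvalid0 m) (hvalid0 m).
by rewrite scaler0 add0r; apply: filterS => z; rewrite scaleN1r addNr.
Qed.

Lemma hcocycle_submod m : submod_closed (hcocycleb m).
Proof.
split; first by apply/asboolP; split; [exact: hvalid0|exact: hdif0].
move=> a b c /asboolP[vb nb] /asboolP[vc nc]; apply/asboolP.
split; first exact: hvalid_lin.
move=> p x; apply: (@hvanish_lin a (hdif m b) (hdif m c)) => // w y.
exact: hdif_lin.
Qed.
HB.instance Definition _ m :=
  GRing.isSubmodClosed.Build K hcochain (hcocycleb m) (hcocycle_submod m).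

Record hcocycle_type (m : int) := HCocycle {
  hcocycle_val :> hcochain; _ : hcocycle_val \in hcocycleb m }.
HB.instance Definition _ m := [isSub for @hcocycle_val m].
HB.instance Definition _ m := [Choice of hcocycle_type m by <:].
HB.instance Definition _ m := [SubChoice_isSubLmodule of hcocycle_type m by <:].

Definition hcobordb (m : int) : {pred hcocycle_type m} :=
  fun c => `[< hcobord m c >].

Lemma hcobord_submod m : submod_closed (@hcobordb m).
Proof.
split.
  apply/asboolP; exists 0; first exact: hvalid0.
  apply: hnull_near => w y.
  have := @hdif_lin (m - 1) (-1) 0 0 w y (hvalid0 _) (hvalid0 _).
  rewrite scaler0 add0r; apply: filterS => z; rewrite scaleN1r addNr => E.
  by rewrite [LHS](_ : _ = 0 - hdif (m - 1) 0 (rcons w y) z) // E subr0.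
move=> a b c /asboolP[b' vb nb] /asboolP[c' vc nc]; apply/asboolP.
exists (a *: b' + c'); first exact: hvalid_lin.
move=> p x.
apply: (@hvanish_lin a (hcocycle_val b - hdif (m - 1) b')
  (hcocycle_val c - hdif (m - 1) c')) => // w y.
apply: filterS (hdif_lin a w y vb vc) => z E.
rewrite [LHS](_ : _ = (a *: hcocycle_val b (rcons w y) z +
  hcocycle_val c (rcons w y) z) -
  hdif (m - 1) (a *: b' + c') (rcons w y) z); last first.
  by [].
rewrite E [X in _ = _ *: X + _](_ : _ = hcocycle_val b (rcons w y) z -
  hdif (m - 1) b' (rcons w y) z) // scalerBr opprD addrACA; congr (_ + _).
Qed.
HB.instance Definition _ m :=
  GRing.isSubmodClosed.Build K (hcocycle_type m) (@hcobordb m) (hcobord_submod m).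

(* The cohomology of the total complex *)
Definition HH (m : int) := Quotient.quot (@hcobordb m).
HB.instance Definition _ m := GRing.Zmodule.on (HH m).
HB.instance Definition _ m := EqQuotient.on (HH m).

Definition HH_scale m (a : K) (h : HH m) : HH m := \pi_(HH m) (a *: repr h).

Lemma HH_scale_pi m a (c : hcocycle_type m) :
  HH_scale a (\pi_(HH m) c) = \pi_(HH m) (a *: c).
Proof.
apply/eqP; rewrite /HH_scale -Quotient.idealrBE -scalerBr rpredZ//.
by rewrite Quotient.idealrBE reprK.
Qed.

Lemma HH_surj m (h : HH m) : exists c, h = \pi_(HH m) c.
Proof. by exists (repr h); rewrite reprK. Qed.

Lemma HH_scaleA m a b (h : HH m) :
  HH_scale a (HH_scale b h) = HH_scale (a * b) h.
Proof. by have [c ->] := HH_surj h; rewrite !HH_scale_pi scalerA. Qed.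

Lemma HH_scale1 m : left_id 1 (@HH_scale m).
Proof. by move=> h; have [c ->] := HH_surj h; rewrite HH_scale_pi scale1r. Qed.

Lemma HH_piD m (c d : hcocycle_type m) :
  \pi_(HH m) (c + d) = \pi_(HH m) c + \pi_(HH m) d.
Proof. exact: (raddfD (\pi_(Quotient.quot (@hcobordb m)))). Qed.

Lemma HH_scaleDr m : right_distributive (@HH_scale m) +%R.
Proof.
move=> a h k; have [c ->] := HH_surj h; have [d ->] := HH_surj k.
by rewrite -HH_piD !HH_scale_pi -HH_piD scalerDr.
Qed.

Lemma HH_scaleDl m (h : HH m) : {morph (@HH_scale m)^~ h : a b / a + b}.
Proof.
by move=> a b; have [c ->] := HH_surj h; rewrite !HH_scale_pi -HH_piD scalerDl.
Qed.

HB.instance Definition _ m := GRing.Zmodule_isLmodule.Build K (HH m)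
  (@HH_scaleA m) (@HH_scale1 m) (@HH_scaleDr m) (@HH_scaleDl m).

(* The total cochain c is a cocycle of class h. *)
Definition represents m (c : hcochain) (h : HH m) : Prop :=
  exists2 z : hcocycle_type m, hcocycle_val z = c & h = \pi_(HH m) z.

End Hypercohomology.
Arguments hcochain {K} X V.
Arguments represents {K X V} F m c h.

Definition cplx (R : realType) : numClosedFieldType := R[i].

(* A complex manifold of dimension n, given by a holomorphic atlas; [unchart i]
   is the inverse of the chart on its image, with arbitrary values elsewhere. *)
Record cmanifold (R : realType) (n : nat) := CManifold {
  cm_space :> topologicalType;
  cm_hausdorff : hausdorff_space cm_space;
  cm_countable : @second_countable cm_space;
  chart_index : Type;
  dom : chart_index -> set cm_space;
  chart : chart_index -> cm_space -> 'rV[cplx R]_n;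
  unchart : chart_index -> 'rV[cplx R]_n -> cm_space;
  dom_open : forall i, open (dom i);
  dom_cover : forall x, exists i, dom i x;
  chartK : forall i x, dom i x -> unchart i (chart i x) = x;
  chart_open : forall i, open (chart i @` dom i);
  chart_continuous : forall i x, dom i x -> {for x, continuous (chart i)};
  unchart_continuous : forall i x, dom i x ->
    {for chart i x, continuous (unchart i)};
  chart_holo : forall i j x, dom i x -> dom j x ->
    differentiable (chart j \o unchart i) (chart i x)
}.

Section Charts.
Context {R : realType} {n : nat} {X : cmanifold R n}.
Local Notation C := (cplx R).
Local Notation chart_index := (chart_index X).
Implicit Types (i j : chart_index) (a b c : 'I_n) (x : X) (f g : X -> C).

Definition holo_at f x : Prop :=
  forall j, dom j x -> differentiable (f \o unchart j) (chart j x).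

(* Partial derivative with respect to the a-th coordinate of the chart i; it is
   set to 0 outside the domain of the chart. *)
Definition pd i a f x : C :=
  if x \in dom i then 'D_(delta_mx 0 a) (f \o unchart i) (chart i x) else 0.

(* In a fixed chart, a differential form is given by its components: the form
   w of degree k has the component w s on dx^{s_1} /\ ... /\ dx^{s_k}, and it is
   extended by 0 to the words s of length different from k.  Multivector fields
   with values in forms have components V I s, with the contravariant indices
   in I. *)
Definition form := seq 'I_n -> X -> C.

Definition extd i (w : form) : form := fun s x =>
  \sum_(p < size s)
     (-1) ^+ p * pd i (tnth (in_tuple s) p) (w (rem_at p s)) x.

Definition fn_form f : form := fun s x => if s is [::] then f x else 0.

Definition dx a : form := fun s _ => (s == [:: a])%:R.

Definition vcontr (v : 'I_n -> X -> C) (w : form) : form := fun s x =>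
  \sum_c v c x * w (c :: s) x.

Definition lie i (v : 'I_n -> X -> C) (w : form) : form := fun s x =>
  vcontr v (extd i w) s x + extd i (vcontr v w) s x.

(* The contraction V (x) w |-> i_V w in the components T I s = V I * w s, where
   i_{v1 /\ ... /\ vk} w = w (v1, ..., vk, ...). *)
Definition contr (k : nat) (T : seq 'I_n -> form) : form := fun s x =>
  (k`!%:R)^-1 * \sum_(I : k.-tuple 'I_n) T I (I ++ s) x.

Section Bivector.
Variable P : seq 'I_n -> X -> C.

(* The vector field pi^sharp w, with <pi^sharp w, u> = pi (w, u) *)
Definition sharp (w : form) : 'I_n -> X -> C := fun b x =>
  \sum_a P [:: a; b] x * w [:: a] x.

Definition pairing (w u : form) : X -> C := fun x =>
  \sum_a \sum_b P [:: a; b] x * w [:: a] x * u [:: b] x.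

Definition pbracket i f g : X -> C :=
  pairing (extd i (fn_form f)) (extd i (fn_form g)).

(* The bracket of 1-forms of the cotangent Lie algebroid *)
Definition cobracket i (w u : form) : form := fun s x =>
  lie i (sharp w) u s x - lie i (sharp u) w s x
  - extd i (fn_form (pairing w u)) s x.

(* The representation on forms of top degree: f dg acts by f L_{X_g}, where
   X_g = pi^sharp (dg), and the coordinate 1-forms dx^a span all 1-forms. *)
Definition nabla i (w : form) (u : form) : form := fun s x =>
  \sum_a w [:: a] x * lie i (sharp (dx a)) u s x.

(* The Cartan formula for the differential of the cotangent Lie algebroid with
   coefficients in [nabla], evaluated at the 1-forms dx^{I_0}, ..., dx^{I_k} *)
Definition dnabla i (V : seq 'I_n -> form) : seq 'I_n -> form := fun I s x =>
  let e p := dx (tnth (in_tuple I) p) in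
  \sum_(p < size I) (-1) ^+ p * nabla i (e p) (V (rem_at p I)) s x +
  \sum_(q < size I) \sum_(p < size I | (p < q)%N) (-1) ^+ (p + q) *
     \sum_c cobracket i (e p) (e q) [:: c] x *
            V (c :: rem_at p (rem_at q I)) s x.

(* i_pi *)
Definition picontr (w : form) : form := contr 2 (fun I s x => P I x * w s x).

(* i_pi d - d i_pi, with d the holomorphic exterior differential *)
Definition kbdif i (w : form) : form := fun s x =>
  picontr (extd i w) s x - extd i (picontr w) s x.

End Bivector.

(* The components, at each point and in each chart, of a tensor field, with the
   contravariant indices first; they are 0 in the charts whose domain does not
   contain the point. *)
Definition tensor := chart_index -> seq 'I_n -> seq 'I_n -> C.
HB.instance Definition _ := GRing.Lmodule.on tensor.

Definition comp (T : X -> tensor) i : seq 'I_n -> form := fun I s x => T x i I s.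

(* The partial derivative at x of the b-th coordinate in the chart j with
   respect to the a-th coordinate in the chart i *)
Definition jac i j x a b : C := pd i a (fun y => chart j y 0 b) x.

Definition antisym (u : seq 'I_n -> C) : Prop := forall s a b t,
  u (s ++ a :: b :: t) = - u (s ++ b :: a :: t).

Record tsection_at (k l : int) (T : X -> tensor) x : Prop := TSectionAt {
  ts_degree : forall i I s, T x i I s != 0 ->
    (size I)%:Z = k /\ (size s)%:Z = l;
  ts_dom : forall i I s, T x i I s != 0 -> dom i x;
  ts_antisymu : forall i s, antisym (fun I => T x i I s);
  ts_antisymd : forall i I, antisym (T x i I);
  ts_holo : forall i I s, dom i x -> holo_at (comp T i I s) x;
  ts_change : forall i j I s, dom i x -> dom j x ->
    T x j I s = \sum_(I' : (size I).-tuple 'I_n) \sum_(s' : (size s).-tuple 'I_n)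
      T x i I' s' *
      \prod_(e <- zip I I') jac i j x e.2 e.1 *
      \prod_(e <- zip s s') jac j i x e.1 e.2
}.

(* The sheaf of holomorphic sections of the tensor product of the k-th exterior
   power of TX and the l-th exterior power of T*X *)
Definition tsection (k l : int) (U : set X) (T : X -> tensor) : Prop :=
  forall x, U x -> tsection_at k l T x.

End Charts.
Arguments form {R n} X.
Arguments tensor {R n} X.

(* A holomorphic Poisson structure: a holomorphic bivector field whose bracket
   satisfies the Jacobi identity on holomorphic functions *)
Record poisson (R : realType) (n : nat) (X : cmanifold R n) := Poisson {
  bivector : X -> tensor X;
  bivector_section : tsection 2 0 setT bivector;
  jacobi : forall i (U : set X) (f g h : X -> cplx R), open U -> U `<=` dom i ->
    (forall x, U x -> [/\ holo_at f x, holo_at g x & holo_at h x]) ->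
    let br := pbracket (fun I => comp bivector i I [::]) i in
    forall x, U x -> br f (br g h) x + br g (br h f) x + br h (br f g) x = 0
}.

Lemma differentiable_near (K : numFieldType) (V W : normedModType K)
    (f g : V -> W) (v : V) :
  (\forall u \near v, f u = g u) -> differentiable f v -> differentiable g v.
Proof.
move=> fg df; have -> : g = f + (g - f) by rewrite addrC subrK.
apply: differentiableD => //; set r := g - f.
have rv : \forall u \near v, r u = 0.
  by apply: filterS fg => u /= fgu; rewrite [LHS](_ : _ = g u - f u) // fgu subrr.
have r0 : r v = 0 by apply: nbhs_singleton rv.
have zc : continuous (\0 : V -> W) by exact: cst_continuous.
have rE : r \o shift v = cst (r v) + \0 +o_ 0 id.
  apply/eqaddoP => e e0; rewrite r0.
  have : \forall h \near (0 : V), r (h + v) = 0.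
    by move: rv; rewrite (near_shift 0 v); apply: filterS => h /=; rewrite subr0.
  apply: filterS => h rh.
  have -> : (r \o shift v - (cst 0 + \0)) h = 0.
    by rewrite [LHS](_ : _ = r (h + v) - (0 + 0)) // rh !addr0 subrr.
  by rewrite normr0; apply: mulr_ge0 => //; exact: ltW.
by apply/diff_locallyP; rewrite (@diff_unique _ _ _ r \0 v zc rE).
Qed.

Section ChartLemmas.
Context {R : realType} {n : nat} {X : cmanifold R n}.
Local Notation C := (cplx R).
Implicit Types (i j : chart_index X) (a b c : 'I_n) (x : X) (f g : X -> C).
Implicit Types (U : set X) (w u : form X).

Lemma near_unchart i x U : open U -> U x -> dom i x ->
  \forall v \near chart i x, U (unchart i v).
Proof.
move=> Uo Ux ix; have ux : U (unchart i (chart i x)) by rewrite chartK.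
by apply: (unchart_continuous ix); apply: open_nbhs_nbhs.
Qed.

Local Notation dfb i x f := (differentiable (f \o unchart i) (chart i x)).

Lemma dfb_loc i x f g U : open U -> U x -> dom i x ->
  {in U, f =1 g} -> dfb i x f -> dfb i x g.
Proof.
move=> Uo Ux ix fg; apply: differentiable_near.
by apply: filterS (near_unchart Uo Ux ix) => v Uv /=; rewrite fg//; exact: mem_set.
Qed.

Lemma dfb_cst i x (k : C) : dfb i x (fun=> k).
Proof. exact: differentiable_cst. Qed.

Lemma dfb_mul i x f g : dfb i x f -> dfb i x g -> dfb i x (fun y => f y * g y).
Proof. by move=> df dg; exact: (differentiableM df dg). Qed.

Lemma dfb_add i x f g : dfb i x f -> dfb i x g -> dfb i x (fun y => f y + g y).
Proof. by move=> df dg; exact: (differentiableD df dg). Qed.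

Lemma dfb_sum i x (I : Type) (r : seq I) (Q : pred I) (F : I -> X -> C) :
  (forall e, dfb i x (F e)) -> dfb i x (fun y => \sum_(e <- r | Q e) F e y).
Proof.
move=> dF; elim: r => [|e r IH].
  rewrite (_ : (fun y => _) = fun=> 0); first exact: dfb_cst.
  by apply/funext => y; rewrite big_nil.
rewrite (_ : (fun y => _) = fun y =>
  (if Q e then F e y else 0) + \sum_(e <- r | Q e) F e y).
  by apply: dfb_add => //; case: (Q e); [exact: dF|exact: dfb_cst].
by apply/funext => y; rewrite big_cons; case: (Q e); rewrite ?add0r.
Qed.

Lemma pdE i a f x : dom i x ->
  pd i a f x = 'D_(delta_mx 0 a) (f \o unchart i) (chart i x).
Proof. by move=> ix; rewrite /pd mem_set. Qed.

Lemma pd_out i a f x : ~ dom i x -> pd i a f x = 0.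
Proof. by move=> ix; rewrite /pd memNset. Qed.

Lemma pd_loc U i a f g x : open U -> U x ->
  (forall y, U y -> f y = g y) -> pd i a f x = pd i a g x.
Proof.
move=> Uo Ux fg; have [ix|ix] := pselect (dom i x); last first.
  by rewrite !(pd_out _ _ ix).
rewrite (pdE _ f ix) (pdE _ g ix); apply: near_eq_derive.
by apply: filterS (near_unchart Uo Ux ix) => v Uv; exact: fg.
Qed.

Lemma pd_lin i a x (k : C) f g h : (dom i x -> dfb i x f) ->
  (dom i x -> dfb i x g) -> (forall y, h y = k * f y + g y) ->
  pd i a h x = k * pd i a f x + pd i a g x.
Proof.
move=> df dg hE; have [ix|ix] := pselect (dom i x); last first.
  by rewrite !(pd_out _ _ ix) mulr0 addr0.
have {}df := df ix; have {}dg := dg ix.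
have hE' : h \o unchart i = k \*: (f \o unchart i) + (g \o unchart i).
  by apply/funext => v; exact: hE.
rewrite (pdE _ h ix) (pdE _ f ix) (pdE _ g ix) hE' deriveD; first by rewrite deriveZ//; exact: diff_derivable.
- by apply: derivableZ; exact: diff_derivable.
- exact: diff_derivable.
Qed.

Local Opaque pd cplx.

Let eqD (a b c d : C) : a = c -> b = d -> a + b = c + d.
Proof. by move=> -> ->. Qed.
Let eqM (a b c : C) : b = c -> a * b = a * c. Proof. by move=> ->. Qed.
Let eqN (a b : C) : a = b -> - a = - b. Proof. by move=> ->. Qed.

Definition eqform U w u := forall s x, U x -> w s x = u s x.

Lemma extd_loc i U w u : open U -> eqform U w u ->
  eqform U (extd i w) (extd i u).
Proof.
move=> Uo wu s x Ux; apply: eq_bigr => p _.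
by rewrite (pd_loc i _ Uo Ux (wu _)).
Qed.

Lemma vcontr_loc U v w u : eqform U w u -> eqform U (vcontr v w) (vcontr v u).
Proof. by move=> wu s x Ux; apply: eq_bigr => c _; rewrite wu. Qed.

Lemma lie_loc i U v w u : open U -> eqform U w u ->
  eqform U (lie i v w) (lie i v u).
Proof.
move=> Uo wu s x Ux; rewrite /lie; apply: eqD.
  exact: (vcontr_loc v (extd_loc i Uo wu) s Ux).
exact: (extd_loc i Uo (vcontr_loc v wu) s Ux).
Qed.

Lemma dnabla_loc P i U (V W : seq 'I_n -> form X) : open U ->
  (forall I, eqform U (V I) (W I)) ->
  forall I, eqform U (dnabla P i V I) (dnabla P i W I).
Proof.
move=> Uo VW I s x Ux; rewrite /dnabla; apply: eqD.
  apply: eq_bigr => p _; apply: eqM; apply: eq_bigr => a _; apply: eqM.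
  exact: (lie_loc i _ Uo (VW _) s Ux).
apply: eq_bigr => q _; apply: eq_bigr => p _; apply: eqM.
by apply: eq_bigr => c _; apply: eqM; exact: VW.
Qed.

Lemma kbdif_loc P i U w u : open U -> eqform U w u ->
  eqform U (kbdif P i w) (kbdif P i u).
Proof.
move=> Uo wu s x Ux; rewrite /kbdif; apply: eqD.
  apply: eqM; apply: eq_bigr => I _; apply: eqM.
  exact: (extd_loc i Uo wu _ Ux).
apply: eqN; apply: (extd_loc i Uo _ s Ux) => t y Uy.
by apply: eqM; apply: eq_bigr => I _; apply: eqM; exact: wu.
Qed.

Definition linform (k : C) (z w u : form X) :=
  forall s y, z s y = k * w s y + u s y.

Lemma extd_lin i k z w u s x :
  (dom i x -> forall t, dfb i x (w t)) -> (dom i x -> forall t, dfb i x (u t)) ->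
  linform k z w u ->
  extd i z s x = k * extd i w s x + extd i u s x.
Proof.
move=> dw du zE; rewrite /extd mulr_sumr -big_split; apply: eq_bigr => p _ /=.
rewrite (@pd_lin i _ x k (w (rem_at p s)) (u (rem_at p s))) //.
- by rewrite mulrDr mulrCA.
- by move=> ix; exact: dw.
- by move=> ix; exact: du.
Qed.

Lemma vcontr_lin k v z w u : linform k z w u ->
  linform k (vcontr v z) (vcontr v w) (vcontr v u).
Proof.
move=> zE s y; rewrite /vcontr mulr_sumr -big_split; apply: eq_bigr => c _ /=.
by rewrite zE mulrDr mulrCA.
Qed.

Lemma lie_lin i k v z w u s x : (dom i x -> forall c, dfb i x (v c)) ->
  (dom i x -> forall t, dfb i x (w t)) -> (dom i x -> forall t, dfb i x (u t)) ->
  linform k z w u ->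
  lie i v z s x = k * lie i v w s x + lie i v u s x.
Proof.
move=> dv dw du zE; rewrite /lie.
rewrite (@extd_lin i k (vcontr v z) (vcontr v w) (vcontr v u)); first last.
- exact: vcontr_lin.
- by move=> ix t; apply: dfb_sum => c; apply: dfb_mul; [exact: dv|exact: du].
- by move=> ix t; apply: dfb_sum => c; apply: dfb_mul; [exact: dv|exact: dw].
rewrite mulrDr addrACA; apply: eqD; last by [].
rewrite /vcontr mulr_sumr -big_split; apply: eq_bigr => c _ /=.
by rewrite (extd_lin _ dw du zE) mulrDr mulrCA.
Qed.

Lemma sharp_dfb P i x a c : (forall I, dfb i x (P I)) ->
  dfb i x (sharp P (dx a) c).
Proof.
move=> dP; apply: dfb_sum => e; apply: dfb_mul => //.
exact: dfb_cst.
Qed.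

Lemma dnabla_lin P i k (Z V W : seq 'I_n -> form X) x :
  (dom i x -> forall I, dfb i x (P I)) ->
  (dom i x -> forall I t, dfb i x (V I t)) ->
  (dom i x -> forall I t, dfb i x (W I t)) ->
  (forall I, linform k (Z I) (V I) (W I)) ->
  forall I s, dnabla P i Z I s x = k * dnabla P i V I s x + dnabla P i W I s x.
Proof.
move=> dP dV dW ZE I s; rewrite /dnabla mulrDr addrACA.
apply: eqD.
  rewrite mulr_sumr -big_split; apply: eq_bigr => p _ /=.
  rewrite mulrCA -mulrDr; apply: eqM.
  rewrite /nabla mulr_sumr -big_split; apply: eq_bigr => a _ /=.
  rewrite mulrCA -mulrDr; apply: eqM.
  apply: lie_lin => // ix.
  - by move=> c; apply: sharp_dfb; exact: dP.
  - exact: dV.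
  - exact: dW.
rewrite mulr_sumr -big_split; apply: eq_bigr => q _ /=.
rewrite mulr_sumr -big_split; apply: eq_bigr => p _ /=.
rewrite mulrCA -mulrDr; apply: eqM.
rewrite mulr_sumr -big_split; apply: eq_bigr => c _ /=.
by rewrite ZE mulrDr mulrCA.
Qed.

Lemma kbdif_lin P i k z w u s x : (dom i x -> forall I, dfb i x (P I)) ->
  (dom i x -> forall t, dfb i x (w t)) -> (dom i x -> forall t, dfb i x (u t)) ->
  linform k z w u ->
  kbdif P i z s x = k * kbdif P i w s x + kbdif P i u s x.
Proof.
move=> dP dw du zE; rewrite /kbdif.
have ipi_dfb v : (dom i x -> forall t, dfb i x (v t)) ->
    dom i x -> forall t, dfb i x (picontr P v t).
  move=> dv ix t; apply: dfb_mul; first exact: dfb_cst.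
  by apply: dfb_sum => I; apply: dfb_mul; [exact: dP|exact: dv].
have ipi_lin : linform k (picontr P z) (picontr P w) (picontr P u).
  move=> t y; rewrite /picontr /contr mulrCA -mulrDr; apply: eqM.
  rewrite mulr_sumr -big_split; apply: eq_bigr => I _ /=.
  by rewrite zE mulrDr mulrCA.
have pE : picontr P (extd i z) s x =
    k * picontr P (extd i w) s x + picontr P (extd i u) s x.
  rewrite /picontr /contr mulrCA -mulrDr; apply: eqM.
  rewrite mulr_sumr -big_split; apply: eq_bigr => I _ /=.
  by rewrite (extd_lin _ dw du zE) mulrDr mulrCA.
have eE := extd_lin s (ipi_dfb _ dw) (ipi_dfb _ du) ipi_lin.
have alg (A B D E G H : C) : A = k * B + D -> E = k * G + H ->
    A - E = k * (B - G) + (D - H).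
  by move=> -> ->; rewrite mulrBr opprD addrACA.
exact: (alg _ _ _ _ _ _ pE eE).
Qed.

Lemma tsection_dfb k l (T : X -> tensor X) x i I s :
  tsection_at k l T x -> dom i x -> dfb i x (comp T i I s).
Proof. by move=> Tx ix; exact: (ts_holo Tx I s ix ix). Qed.

Lemma tsection_loc k l U (T : X -> tensor X) : open U -> tsection k l U T <->
  (forall x, U x -> exists W, [/\ open W, W x & tsection k l W T]).
Proof.
move=> Uo; split=> [TU x Ux|TU x Ux]; first by exists U.
by have [W [_ Wx TW]] := TU x Ux; exact: TW.
Qed.

Lemma tsection_ext k l U (T S : X -> tensor X) : open U ->
  {in U, T =1 S} -> tsection k l U T -> tsection k l U S.
Proof.
move=> Uo TS TU x Ux; have TSx : T x = S x by apply: TS; exact: mem_set.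
have [dg dm au ad ho ch] := TU x Ux; rewrite TSx in dg dm au ad ch.
split=> // i I s ix j jx; apply: (dfb_loc Uo Ux jx _ (ho i I s ix j jx)).
by move=> y Uy; rewrite /comp TS.
Qed.

Lemma tsection0 k l U : tsection k l U (0 : X -> tensor X).
Proof.
move=> x _; split.
- by move=> i I s /negP[].
- by move=> i I s /negP[].
- by move=> i s t a b t'; rewrite -[RHS]/(- 0) oppr0.
- by move=> i s t a b t'; rewrite -[RHS]/(- 0) oppr0.
- by move=> i I s _ j _; exact: dfb_cst.
- move=> i j I s _ _; rewrite big1// => I' _; rewrite big1// => s' _.
  by rewrite -[(0 : X -> tensor X) x i I' s']/(0 : C) !mul0r.
Qed.

Lemma tsection_lin k l U (a : C) (T S : X -> tensor X) :
  tsection k l U T -> tsection k l U S -> tsection k l U (a *: T + S).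
Proof.
move=> TU SU x Ux; have Tx := TU x Ux; have Sx := SU x Ux.
have E y i I s : (a *: T + S) y i I s = a * T y i I s + S y i I s by [].
split.
- move=> i I s; rewrite E; have [->|T0 _] := eqVneq (T x i I s) 0.
    by rewrite mulr0 add0r; exact: (ts_degree Sx).
  exact: (ts_degree Tx T0).
- move=> i I s; rewrite E; have [->|T0 _] := eqVneq (T x i I s) 0.
    by rewrite mulr0 add0r; exact: (ts_dom Sx).
  exact: (ts_dom Tx T0).
- move=> i s t b c t'; rewrite !E (ts_antisymu Tx) (ts_antisymu Sx).
  by rewrite mulrN opprD.
- move=> i s t b c t'; rewrite !E (ts_antisymd Tx) (ts_antisymd Sx).
  by rewrite mulrN opprD.
- move=> i I s ix j jx; apply: dfb_add; last exact: (ts_holo Sx I s ix jx).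
  by apply: dfb_mul; [exact: dfb_cst|exact: (ts_holo Tx I s ix jx)].
- move=> i j I s ix jx; rewrite E (ts_change Tx I s ix jx).
  rewrite (ts_change Sx I s ix jx) mulr_sumr -big_split; apply: eq_bigr => I' _.
  rewrite mulr_sumr -big_split; apply: eq_bigr => s' _ /=.
  by rewrite E !mulrDl !mulrA.
Qed.

End ChartLemmas.

Section Poisson.
Context {R : realType} {n : nat} {X : cmanifold R n}.
Local Notation C := (cplx R).
Variable pi : poisson X.

Let P i : seq 'I_n -> X -> C := fun I => comp (bivector pi) i I [::].

Definition lp_dif (T : X -> tensor X) : X -> tensor X := fun x i I s =>
  dnabla (P i) i (comp T i) I s x.

Definition kb_dif (T : X -> tensor X) : X -> tensor X := fun x i I s =>
  if I is [::] then kbdif (P i) i (comp T i [::]) s x else 0.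

Let P_dfb i x I : dom i x -> differentiable (P i I \o unchart i) (chart i x).
Proof. by move=> ix; exact: (tsection_dfb _ _ (@bivector_section _ _ _ pi x Logic.I) ix). Qed.

Lemma lp_dif_loc (U : set X) T S : open U ->
  {in U, T =1 S} -> {in U, lp_dif T =1 lp_dif S}.
Proof.
move=> Uo TS x Ux; apply/funext => i; apply/funext => I; apply/funext => s.
apply: (dnabla_loc (P i) i Uo _ I s (set_mem Ux)) => J t y Uy.
by rewrite /comp TS//; exact: mem_set.
Qed.

Lemma kb_dif_loc (U : set X) T S : open U ->
  {in U, T =1 S} -> {in U, kb_dif T =1 kb_dif S}.
Proof.
move=> Uo TS x Ux; apply/funext => i; apply/funext => -[|//]; apply/funext => s.
apply: (kbdif_loc (P i) i Uo _ s (set_mem Ux)) => t y Uy.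
by rewrite /comp TS//; exact: mem_set.
Qed.

Lemma lp_dif_lin k l (U : set X) (a : C) T S : open U ->
  tsection k l U T -> tsection k l U S ->
  {in U, lp_dif (a *: T + S) =1 a *: lp_dif T + lp_dif S}.
Proof.
move=> Uo TU SU x /set_mem Ux.
apply/funext => i; apply/funext => I; apply/funext => s.
apply: dnabla_lin => //.
- by move=> ix J; exact: P_dfb.
- by move=> ix J t; exact: (tsection_dfb _ _ (TU _ Ux) ix).
- by move=> ix J t; exact: (tsection_dfb _ _ (SU _ Ux) ix).
Qed.

Lemma kb_dif_lin k l (U : set X) (a : C) T S : open U ->
  tsection k l U T -> tsection k l U S ->
  {in U, kb_dif (a *: T + S) =1 a *: kb_dif T + kb_dif S}.
Proof.
move=> Uo TU SU x /set_mem Ux.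
apply/funext => i; apply/funext => I; apply/funext => s.
rewrite -[RHS]/(a * kb_dif T x i I s + kb_dif S x i I s) /kb_dif.
case: I => [|? ?]; last by rewrite mulr0 addr0.
apply: kbdif_lin => //.
- by move=> ix J; exact: P_dfb.
- by move=> ix t; exact: (tsection_dfb _ _ (TU _ Ux) ix).
- by move=> ix t; exact: (tsection_dfb _ _ (SU _ Ux) ix).
Qed.

(* The Lichnerowicz-Poisson complex with coefficients in the n-th exterior power
   of T*X: in degree k, the tensor product of the k-vector fields with the
   n-forms *)
Definition lp_complex : sheaf_complex X (tensor X) :=
  @SheafComplex C X (tensor X) (fun k => tsection k n) (fun=> lp_dif)
    (fun k => tsection_loc k n) (fun k => tsection_ext (k := k) (l := n))
    (fun k => tsection0 k n) (fun k => tsection_lin (k := k) (l := n))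
    (fun=> lp_dif_loc) (fun k => lp_dif_lin (k := k) (l := n)).

(* The Koszul-Brylinski complex, with the (n - k)-forms in degree k *)
Definition kb_complex : sheaf_complex X (tensor X) :=
  @SheafComplex C X (tensor X) (fun k => tsection 0 (n%:Z - k)) (fun=> kb_dif)
    (fun k => tsection_loc 0 (n%:Z - k))
    (fun k => tsection_ext (k := 0) (l := n%:Z - k))
    (fun k => tsection0 0 (n%:Z - k))
    (fun k => tsection_lin (k := 0) (l := n%:Z - k))
    (fun=> kb_dif_loc) (fun k => kb_dif_lin (k := 0) (l := n%:Z - k)).

Definition lp_cohomology (k : int) := HH lp_complex k.
Definition kb_homology (j : int) := HH kb_complex ((2 * n)%:Z - j).
HB.instance Definition _ k := GRing.Lmodule.on (lp_cohomology k).
HB.instance Definition _ j := GRing.Lmodule.on (kb_homology j).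

End Poisson.

(* The contraction V (x) alpha |-> i_V alpha, on k-vector fields with values in
   forms *)
Definition tau {R : realType} {n : nat} {X : cmanifold R n} (k : int)
    (T : X -> tensor X) : X -> tensor X := fun x i I s =>
  if I is [::] then contr `|k|%N (comp T i) s x else 0.

(* Since tau intertwines the differentials up to the sign (-1)^(k+1), the
   morphism to the complex with differential kb_dif is eps_k tau with
   eps_0 = 1 and eps_(k+1) = (-1)^(k+1) eps_k. *)
Definition tau_sign {R : realType} (k : int) : cplx R :=
  (-1) ^+ 'C(`|k|.+1, 2).

(* The map induced on total cochains of degree m: a word of p + 1 points has as
   value a germ in degree m - p. *)
Definition tau_hcochain {R : realType} {n : nat} {X : cmanifold R n} (m : int)
    (c : hcochain X (tensor X)) : hcochain X (tensor X) := fun w =>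
  let k := m - (size w).-1%:Z in tau_sign k *: tau k (c w).

(* Main.v *)
(* Contraction with an n-form identifies the k-vector fields with values in
   n-forms with the (n - k)-forms, fibre by fibre.  In a chart both
   differentials are first order: on n-forms the representation of dx^a is
   sum_c P^{ac} d_c + sum_c (d_c P^{ac}), the structure functions of the
   cotangent Lie algebroid are d_c P^{ab}, and i_pi d - d i_pi only involves P
   and dP.  Both sides of the intertwining relation are thus linear in P and in
   dP.  The terms in P match at once; the terms in dP match because a covector
   wedged with an n-form vanishes, which lets an index be moved between the
   multivector and the form.  The Jacobi identity is not involved.  A signed
   isomorphism of complexes of sheaves, applied germ by germ to the total
   cochains of the Godement resolution, is bijective on hypercohomology. *)

From HB Require Import structures.
From mathcomp Require Import all_boot all_order all_algebra ring_quotient.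
From mathcomp Require Import all_classical all_reals all_analysis.
From mathcomp Require Import ring zify.
Require Import Defs.

Set Implicit Arguments.
Unset Strict Implicit.
Unset Printing Implicit Defensive.

Import Order.TTheory GRing.Theory Num.Theory numFieldNormedType.Exports.

Local Open Scope ring_scope.

(** * Words and alternating sums *)

(** On the analytic side the obstacle is that [dif] is not known to send sections to sections, so
    injectivity of tau on sections would not reach the values of [hdif m c]. Injectivity is
    therefore stated value by value, on a predicate ([good], realized by [top_tensor]) that keeps
    only degrees and antisymmetry and that both sections and their differentials satisfy. Identities
    between differentials are transported back along tau by this injectivity, while the local
    inverse of tau serves to lift cochains. On the algebraic side, the exterior differential, the
    wedge product with a covector and Cartan's formula are all written with one operator, [altsum].
    Signs of permutations are cancelled by multiplying two antisymmetric functions, one of them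
    often the Levi-Civita symbol [volume]. The transition law of the inverse contraction is again a
    consequence of injectivity. *)

Section TupleSums.
Context {C : nmodType} {A : finType}.
Implicit Types f : seq A -> C.

Lemma sum_tuple0 f : \sum_(I : 0.-tuple A) f I = f [::].
Proof.
rewrite (big_pred1 [tuple]) // => I.
by rewrite (tuple0 I); apply/esym/eqP.
Qed.

Lemma sum_tuple_cons k f :
  \sum_(I : k.+1.-tuple A) f I = \sum_a \sum_(J : k.-tuple A) f (a :: J).
Proof.
rewrite pair_bigA /=.
rewrite (reindex (fun u : A * k.-tuple A => [tuple of u.1 :: u.2])) //=.
exists (fun I => (thead I, [tuple of behead I])) => [[a J] _|I _] /=.
  by congr (_, _); exact: val_inj.
by rewrite -tuple_eta.
Qed.

End TupleSums.

Section AlternatingSums.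
Context {R : realType} {n : nat}.
Local Notation C := (cplx R).
Local Opaque cplx.
Implicit Types (a b c : 'I_n) (s t I J : seq 'I_n) (u v : seq 'I_n -> C).
Implicit Types f : 'I_n -> seq 'I_n -> C.

(** With [f] a partial derivative this is the exterior differential, with
    [f a t = (a == c)%:R * u t] the wedge product of dx^c with [u]; iterated, it gives the bracket
    part of Cartan's formula. *)
Definition altsum f s : C :=
  \sum_(p < size s) (-1) ^+ p * f (tnth (in_tuple s) p) (rem_at p s).

Lemma altsum_nil f : altsum f [::] = 0.
Proof. by rewrite /altsum big_ord0. Qed.

Lemma altsum_cons f a s :
  altsum f (a :: s) = f a s - altsum (fun b t => f b (a :: t)) s.
Proof.
rewrite /altsum big_ord_recl expr0 mul1r /rem_at /= drop0 -sumrN.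
congr (_ + _); apply: eq_bigr => p _.
by rewrite /bump /= add1n exprS mulN1r mulNr !(tnth_nth a).
Qed.

Lemma altsum_cons2 f a b s : altsum f [:: a, b & s] =
  f a (b :: s) - f b (a :: s) + altsum (fun c t => f c [:: a, b & t]) s.
Proof. by rewrite !altsum_cons opprB addrA addrAC. Qed.

Lemma eq_altsum f g s : f =2 g -> altsum f s = altsum g s.
Proof. by move=> fg; apply: eq_bigr => p _; rewrite fg. Qed.

Lemma altsum_lin k f g h s : (forall a t, h a t = k * f a t + g a t) ->
  altsum h s = k * altsum f s + altsum g s.
Proof.
move=> hE; rewrite /altsum mulr_sumr -big_split; apply: eq_bigr => p _ /=.
by rewrite hE mulrDr mulrCA.
Qed.

Lemma altsumD f g s :
  altsum (fun a t => f a t + g a t) s = altsum f s + altsum g s.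
Proof.
rewrite (@altsum_lin 1 f g) ?mul1r // => a t; by rewrite mul1r.
Qed.

Lemma altsumZ k f s : altsum (fun a t => k * f a t) s = k * altsum f s.
Proof.
rewrite /altsum mulr_sumr; apply: eq_bigr => p _; by rewrite mulrCA.
Qed.

Lemma altsumN f s : altsum (fun a t => - f a t) s = - altsum f s.
Proof.
by rewrite -mulN1r -altsumZ; apply: eq_altsum => a t; rewrite mulN1r.
Qed.

Lemma altsum_sum (T : finType) (F : T -> 'I_n -> seq 'I_n -> C) s :
  altsum (fun a t => \sum_i F i a t) s = \sum_i altsum (F i) s.
Proof.
rewrite /altsum exchange_big; apply: eq_bigr => p _ /=.
by rewrite mulr_sumr.
Qed.

(** Swapping two adjacent letters exchanges, with opposite signs, the two terms in which one of them
    is taken out; in the other terms the pair stays in the word and [f] changes sign. *)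
Lemma altsum_antisym f : (forall a, antisym (f a)) -> antisym (altsum f).
Proof.
move=> fA s; elim: s f fA => [|e s IH] f fA a b t.
  rewrite /= !altsum_cons.
  rewrite (@eq_altsum (fun c r => f c [:: a, b & r])
    (fun c r => - f c [:: b, a & r])); last by move=> c r; exact: (fA c [::]).
  by rewrite altsumN; ring.
rewrite /= !altsum_cons IH => [|c s' a' b' t']; last exact: (fA c (e :: s')).
by rewrite fA; ring.
Qed.

Lemma altsum_size m f s : (forall a t, f a t != 0 -> (size t).+1 = m) ->
  altsum f s != 0 -> size s = m.
Proof.
move=> fm; apply: contra_neq_eq => sm; rewrite /altsum big1 // => p _.
suff -> : f (tnth (in_tuple s) p) (rem_at p s) = 0 by rewrite mulr0.
apply: contra_neq_eq sm => /fm <-; rewrite size_cat size_take size_drop ltn_ord.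
by rewrite -addSn subnKC.
Qed.

Lemma altsum_cat f s t :
  altsum f (s ++ t) = altsum (fun a r => f a (r ++ t)) s +
                      (-1) ^+ size s * altsum (fun a r => f a (s ++ r)) t.
Proof.
elim: s f => [|a s IH] f /=.
  by rewrite altsum_nil expr0 mul1r add0r.
by rewrite !altsum_cons IH exprS mulN1r opprD mulNr addrA.
Qed.

(* Moving the letter taken out of a word to the front of that word costs the
   sign which it carries in the alternating sum. *)
Lemma sum_altsum k (F : 'I_n -> seq 'I_n -> seq 'I_n -> C) :
  (forall a J, antisym (F a J)) ->
  \sum_(I : k.-tuple 'I_n) altsum (fun a J => F a J I) I =
  k%:R * \sum_a \sum_(J : k.-1.-tuple 'I_n) F a J (a :: J).
Proof.
elim: k F => [|k IH] F FA.
  rewrite (sum_tuple0 (fun I => altsum (fun a J => F a J I) I)).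
  by rewrite altsum_nil mul0r.
rewrite (sum_tuple_cons k (fun I => altsum (fun a J => F a J I) I)).
transitivity (\sum_b (\sum_(J : k.-tuple 'I_n) F b J (b :: J) -
    \sum_(J : k.-tuple 'I_n) altsum (fun a L => F a (b :: L) (b :: J)) J)).
  apply: eq_bigr => b _; rewrite -sumrB; apply: eq_bigr => J _.
  by rewrite altsum_cons.
rewrite sumrB mulrS mulrDl mul1r; congr (_ + _).
under [X in - X]eq_bigr => b _.
  rewrite (IH (fun a L t => F a (b :: L) (b :: t))); last first.
    by move=> a J s; exact: (FA a _ (b :: s)).
  over.
case: k {IH} => [|k]; first by rewrite big1 ?oppr0 ?mul0r// => b _; rewrite mul0r.
rewrite -mulr_sumr -mulrN; congr (_ * _); rewrite exchange_big -sumrN.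
apply: eq_bigr => a _; rewrite (sum_tuple_cons k (fun J => F a J (a :: J))).
rewrite -sumrN; apply: eq_bigr => b _; rewrite -sumrN; apply: eq_bigr => J _.
by rewrite (FA a _ [::]) opprK.
Qed.

(** Taking out two letters in succession meets each pair of positions twice. When the letter removed
    second stands further right, its index has dropped by one; the antisymmetry of [g] absorbs this
    sign, so both orders contribute equally, whence the factor 1/2. *)
Lemma double_altsum (g : 'I_n -> 'I_n -> seq 'I_n -> C) I :
  (forall a b L, g a b L = - g b a L) ->
  \sum_(q < size I) \sum_(p < size I | (p < q)%N) (-1) ^+ (p + q) *
    g (tnth (in_tuple I) p) (tnth (in_tuple I) q) (rem_at p (rem_at q I)) =
  2^-1 * altsum (fun b J => altsum (fun a L => g a b L) J) I.
Proof.
elim: I g => [|e I IH] g gA; first by rewrite big_ord0 altsum_nil mulr0.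
rewrite altsum_cons.
rewrite (@eq_altsum (fun b t => altsum (g^~ b) (e :: t)) (fun b t => g e b t +
  - altsum (fun a L => g a b (e :: L)) t)); last first.
  by move=> b t; rewrite altsum_cons.
rewrite altsumD altsumN (@eq_altsum (g^~ e) (fun a L => - g e a L)) ; last first.
  by move=> a L.
rewrite altsumN.
transitivity (- altsum (g e) I + \sum_(q < size I) \sum_(p < size I | (p < q)%N)
    (-1) ^+ (p + q) * g (tnth (in_tuple I) p) (tnth (in_tuple I) q)
      (e :: rem_at p (rem_at q I))); last first.
  rewrite (IH (fun a b L => g a b (e :: L))) //.
  by set X := altsum (g e) I; set Y := altsum _ I; field.
rewrite big_ord_recl big_pred0 ?add0r // -sumrN -big_split.
apply: eq_bigr => q _ /=; rewrite big_mkcond big_ord_recl /=; congr (_ + _).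
  rewrite /bump /= add0n add1n exprS mulN1r mulNr !(tnth_nth e) /=.
  by rewrite /rem_at /= !drop0 /rem_at.
rewrite [RHS]big_mkcond; apply: eq_bigr => p _ /=.
rewrite /bump /= !add1n ltnS; case: ifP => // pq.
by rewrite addSn addnS !exprS !mulN1r opprK !(tnth_nth e).
Qed.

End AlternatingSums.

(** * Antisymmetric functions on words *)

(** Adjacent transpositions generate all permutations: [mv] carries a letter to the front by such
    swaps, and the induction runs behind a growing prefix [r]. *)
Lemma symmetric_perm (T : eqType) (A : Type) (g : seq T -> A) :
  (forall s a b t, g (s ++ a :: b :: t) = g (s ++ b :: a :: t)) ->
  forall s t, perm_eq s t -> g s = g t.
Proof.
move=> gS s t st.
have mv r t1 a t2 : g (r ++ t1 ++ a :: t2) = g (r ++ a :: t1 ++ t2).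
  elim: t1 r => [//|b t1 IH] r /=.
  by rewrite -(cat_rcons b r) IH cat_rcons /= gS.
suff : forall r, g (r ++ s) = g (r ++ t) by move/(_ [::]).
elim: s t st => [|a s IH] t st r.
  by move: st; rewrite perm_sym => /perm_nilP ->.
have /path.splitPr at_ : a \in t by rewrite -(perm_mem st) mem_head.
case: at_ st => t1 t2 st; rewrite mv -!cat_rcons; apply: IH.
by rewrite -(perm_cons a) (perm_trans st)// -[a :: t2]cat1s perm_catCA.
Qed.

(** The contributing tuples are the rearrangements of [s]; as its letters are distinct, there are
    exactly k! of them. *)
Lemma sum_tuple_perm (C : pzSemiRingType) (T : finType) k (g : seq T -> C) (s : seq T) :
  uniq s -> size s = k ->
  (forall J, size J = k -> ~~ perm_eq J s -> g J = 0) ->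
  (forall J, perm_eq J s -> g J = g s) ->
  \sum_(J : k.-tuple T) g J = k`!%:R * g s.
Proof.
move=> su <- g0 gs.
rewrite (bigID (fun J : (size s).-tuple T => perm_eq J s)) /=.
rewrite [X in _ + X]big1 ?addr0; last first.
  by move=> J Js; apply: g0 => //; rewrite size_tuple.
rewrite (eq_bigr (fun=> g s)); last by move=> J; exact: gs.
rewrite sumr_const mulr_natl; congr (_ *+ _).
rewrite -(size_permutations su) cardE.
rewrite -(size_map (fun J : (size s).-tuple T => J : seq T)).
apply/perm_size/uniq_perm.
- by rewrite map_inj_uniq ?enum_uniq//; exact: val_inj.
- exact: permutations_uniq.
move=> J; rewrite mem_permutations; apply/mapP/idP => [[L]|Js].
  by rewrite mem_enum => Ls ->.
have JT : size J == size s by rewrite (perm_size Js).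
by exists (Tuple JT) => //; rewrite mem_enum.
Qed.

Section Antisymmetric.
Context {R : realType} {n : nat}.
Local Notation C := (cplx R).
Local Opaque cplx.
Implicit Types (a b c : 'I_n) (s t I J : seq 'I_n) (u v : seq 'I_n -> C).

Lemma antisym_catl r u : antisym u -> antisym (fun t => u (r ++ t)).
Proof. by move=> uA s a b t; rewrite !catA uA. Qed.

Lemma antisym_move u s t a r : antisym u ->
  u (s ++ t ++ a :: r) = (-1) ^+ size t * u (s ++ a :: t ++ r).
Proof.
move=> uA; elim: t s => [|b t IH] s /=; first by rewrite expr0 mul1r.
by rewrite -(cat_rcons b s) IH cat_rcons uA exprS mulrN mulN1r mulNr.
Qed.

(** The sign of the permutation occurs squared. Taking [volume] as second factor, this turns
    equalities up to sign into equalities. *)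
Lemma antisym_mul_perm u v s t : antisym u -> antisym v -> perm_eq s t ->
  u s * v s = u t * v t.
Proof.
move=> uA vA; apply: (symmetric_perm (g := fun r => u r * v r)) => r a b q.
by rewrite uA vA mulrNN.
Qed.

Lemma antisym_nuniq u s : antisym u -> ~~ uniq s -> u s = 0.
Proof.
elim: s u => [//|a s IH] u uA /=; rewrite negb_and negbK => /orP[|sN].
  case/path.splitPr => t r; apply/eqP; rewrite -[_ :: _]cat1s antisym_move//.
  (* With the two equal letters side by side at the front, antisymmetry gives u = - u, hence u = 0
     in characteristic zero. *)
  rewrite -[[:: a] ++ _]cat0s; have := uA [::] a a (t ++ r) => /= /eqP.
  rewrite -addr_eq0 -mulr2n mulrn_eq0 /= => /eqP ->; by rewrite mulr0.
exact: (IH (fun t => u (a :: t)) (antisym_catl [:: a] uA)).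
Qed.

Lemma uniq_size_le s : uniq s -> (size s <= n)%N.
Proof. by move=> /card_uniqP <-; rewrite (leq_trans (max_card _))// card_ord. Qed.

Lemma uniq_perm_enum s : uniq s -> size s = n -> perm_eq s (enum 'I_n).
Proof.
move=> su sn; apply: uniq_perm (enum_uniq _) _ => // a.
have se : {subset s <= enum 'I_n} by move=> b _; rewrite mem_enum.
by have [|_ ->] := uniq_min_size su se; first by rewrite size_enum_ord sn.
Qed.

Lemma antisym_big u s : antisym u -> (n < size s)%N -> u s = 0.
Proof.
move=> uA sn; apply: antisym_nuniq => //; apply: contraTN sn => /uniq_size_le.
by rewrite -leqNgt.
Qed.

Lemma uniq_complement s : uniq s ->
  exists I, size I = (n - size s)%N /\ perm_eq (I ++ s) (enum 'I_n).
Proof.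
move=> su; have sE : perm_eq s [seq a <- enum 'I_n | a \in s].
  apply: uniq_perm => //; first by rewrite filter_uniq ?enum_uniq.
  by move=> a; rewrite mem_filter mem_enum andbT.
exists [seq a <- enum 'I_n | a \notin s]; have sP :
    perm_eq ([seq a <- enum 'I_n | a \notin s] ++ s) (enum 'I_n).
  rewrite perm_catC (perm_trans _ (introT permPl (perm_filterC (mem s) _)))//.
  by rewrite perm_cat2r.
split=> //; have := perm_size sP; rewrite size_cat size_enum_ord => sn.
by apply/eqP; rewrite -(eqn_add2r (size s)) sn subnK// uniq_size_le.
Qed.

(* This is the wedge product of dx^c with u, and there is no nonzero form of
   degree n + 1. *)
Lemma altsum_top u c s : antisym u -> (forall t, u t != 0 -> size t = n) ->
  altsum (fun d t => (d == c)%:R * u t) s = 0.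
Proof.
move=> uA un; set f := fun d t => _.
have fA : antisym (altsum f).
  by apply: altsum_antisym => d r a b t; rewrite /f uA mulrN.
apply/eqP; apply: contraT => fs; have /(_ _ fs) sn := @altsum_size _ _ n.+1 f s.
move: fs; rewrite antisym_big ?eqxx// sn// => d t.
by rewrite /f mulf_eq0 negb_or => /andP[_ /un ->].
Qed.

(** The Levi-Civita symbol, built as the iterated wedge product of the coordinate covectors so that
    its antisymmetry and degree follow from those of [altsum]. *)
Definition volume : seq 'I_n -> C :=
  foldr (fun c u => altsum (fun a t => (a == c)%:R * u t))
    (fun t => (t == [::])%:R) (enum 'I_n).

Lemma volume_antisym : antisym volume.
Proof.
rewrite /volume; elim: (enum 'I_n) => [|c l IH] /=.
  by move=> [|? ?] a b t; rewrite oppr0.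
by apply: altsum_antisym => d r a b t; rewrite IH mulrN.
Qed.

Lemma volume_size s : volume s != 0 -> size s = n.
Proof.
rewrite -[RHS]size_enum_ord /volume.
elim: (enum 'I_n) s => [|c l IH] /= s.
  by case: s => //= a s; rewrite eqxx.
by apply: altsum_size => a t; rewrite mulf_eq0 negb_or => /andP[_ /IH ->].
Qed.

Lemma volume_enum : volume (enum 'I_n) = 1.
Proof.
rewrite /volume; elim: (enum 'I_n) (enum_uniq 'I_n) => [//|c l IH] /= /andP[cl lu].
rewrite altsum_cons eqxx mul1r IH// /altsum big1 ?subr0// => p _.
suff -> : (tnth (in_tuple l) p == c) = false by rewrite mul0r mulr0.
by apply: contraNF cl => /eqP <-; exact: mem_tnth.
Qed.

Lemma volume_sqr s : uniq s -> size s = n -> volume s * volume s = 1.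
Proof.
move=> su sn; rewrite (antisym_mul_perm volume_antisym volume_antisym
  (uniq_perm_enum su sn)).
by rewrite volume_enum mulr1.
Qed.

Lemma volume_perm s : volume s != 0 -> perm_eq s (enum 'I_n).
Proof.
move=> s0; apply: uniq_perm_enum (volume_size s0).
by apply: contra_neqT s0 => /(antisym_nuniq volume_antisym).
Qed.

(** Reordering [J] changes the sign through both arguments of [T J (J ++ s)], so the value is
    symmetric in [J]; it vanishes unless [J] completes [s] to an ordering of all indices, that is,
    unless [J] rearranges [I]. There remain k! equal terms. *)
Lemma contract_value k (T : seq 'I_n -> seq 'I_n -> C) I s :
  (forall J, antisym (T J)) -> (forall t, antisym (T^~ t)) ->
  (forall J t, T J t != 0 -> size t = n) ->
  size I = k -> perm_eq (I ++ s) (enum 'I_n) ->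
  (k`!%:R)^-1 * \sum_(J : k.-tuple 'I_n) T J (J ++ s) = T I (I ++ s).
Proof.
move=> TA TA' Tn Ik Is; have Isu : uniq (I ++ s) by rewrite (perm_uniq Is) enum_uniq.
have Iu : uniq I by move: Isu; rewrite cat_uniq => /andP[].
rewrite (sum_tuple_perm (g := fun J => T J (J ++ s)) Iu Ik).
- by rewrite mulKf// pnatr_eq0 -lt0n fact_gt0.
- move=> J _; apply: contraNeq => TJ; have Jn := Tn _ _ TJ.
  have Ju : uniq (J ++ s) by apply: contra_neqT TJ => /(antisym_nuniq (TA J)).
  rewrite -(perm_cat2r s); apply: (perm_trans (uniq_perm_enum Ju Jn)).
  by rewrite perm_sym.
move=> J JI; apply: (symmetric_perm (g := fun J => T J (J ++ s))) JI => r a b t.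
by rewrite TA' -!catA /= TA opprK.
Qed.

(** Evaluated on the indices complementary to [I], the contraction isolates the component
    [T I (I ++ s)]; both [t] and [I ++ s] order all the indices, so this is [T I t] up to sign. *)
Lemma contract_inj k (T : seq 'I_n -> seq 'I_n -> C) :
  (forall J, antisym (T J)) -> (forall t, antisym (T^~ t)) ->
  (forall J t, T J t != 0 -> size J = k /\ size t = n) ->
  (forall s, \sum_(J : k.-tuple 'I_n) T J (J ++ s) = 0) ->
  forall I t, T I t = 0.
Proof.
move=> TA TA' Tkn T0 I t; apply/eqP; apply: contraT => TIt.
have [Ik tn] := Tkn _ _ TIt.
have tu : uniq t by apply: contra_neqT TIt => /(antisym_nuniq (TA I)).
have Iu : uniq I by apply: contra_neqT TIt => /(antisym_nuniq (TA' t)).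
have [s [_ sI]] := uniq_complement Iu; rewrite perm_catC in sI.
have := contract_value TA TA' (fun J t TJt => (Tkn J t TJt).2) Ik sI.
rewrite T0 mulr0 => TIs.
have tP := uniq_perm_enum tu tn.
(* Multiplication by [volume] removes the unknown sign between [t] and [I ++ s]; the factor
   [volume t] is then cancelled by [volume_sqr]. *)
have := antisym_mul_perm (TA I) volume_antisym (perm_trans tP (_ : perm_eq _ (I ++ s))).
rewrite perm_sym => /(_ sI); rewrite -TIs mul0r => /(congr1 (fun z => z * volume t)).
by rewrite -mulrA volume_sqr// mulr1 mul0r => T00; move: TIt; rewrite T00 eqxx.
Qed.

(** The inverse of contraction, for a form [w] of degree [m]: a Hodge-type dual multivector in [I],
    tensored with the volume form in [t]. Under a change of frame the two [volume] factors acquire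
    inverse determinants, so the product has an invariant meaning. *)
Definition uncontract (m : nat) (w : seq 'I_n -> C) I t : C :=
  (m`!%:R)^-1 * \sum_(J : m.-tuple 'I_n) volume (I ++ J) * volume t * w J.

Lemma uncontract_antisymu m w t : antisym (uncontract m w ^~ t).
Proof.
move=> r a b s; rewrite /uncontract -mulrN -sumrN; congr (_ * _).
by apply: eq_bigr => J _; rewrite -!catA /= volume_antisym !mulNr.
Qed.

Lemma uncontract_antisymd m w I : antisym (uncontract m w I).
Proof.
move=> r a b s; rewrite /uncontract -mulrN -sumrN; congr (_ * _).
by apply: eq_bigr => J _; rewrite volume_antisym mulrN mulNr.
Qed.

Lemma uncontract_size m w I t : uncontract m w I t != 0 ->
  (size I + m)%N = n /\ size t = n.
Proof.
move=> wIt; apply/and_comm/and_comm; move: wIt; apply: contra_neqP => It.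
rewrite /uncontract big1 ?mulr0// => J _; apply/eqP; apply: contraT.
rewrite !mulf_eq0 !negb_or -andbA => /and3P[/volume_size IJ /volume_size tn _].
by case: It; split=> //; move: IJ; rewrite size_cat size_tuple.
Qed.

(** By [contract_value] a single [I] complementary to [s] matters; inside [uncontract] only the m!
    rearrangements of [s] then survive, each contributing the square of [volume (I ++ s)] times
    [w s]. *)
Lemma uncontract_contract k m w s : (k + m)%N = n -> antisym w ->
  (forall J, w J != 0 -> size J = m) ->
  (k`!%:R)^-1 * \sum_(I : k.-tuple 'I_n) uncontract m w I (I ++ s) = w s.
Proof.
move=> kmn wA wm.
set S := \sum_(I : _) _; have [sm|sm] := eqVneq (size s) m; last first.
  rewrite /S big1 ?mulr0; last first.
    move=> I _; apply: contra_neq_eq sm => /uncontract_size[_].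
    by rewrite size_cat size_tuple; lia.
  by apply/esym; apply: contra_neq_eq sm => /wm.
have [su|su] := boolP (uniq s); last first.
  rewrite (antisym_nuniq wA su) /S big1 ?mulr0// => I _.
  apply: antisym_nuniq (uncontract_antisymd m w I) _.
  by rewrite cat_uniq negb_and negb_and su !orbT.
have [I [Ik Is]] := uniq_complement su.
have {}Ik : size I = k by rewrite Ik sm; lia.
rewrite (contract_value (uncontract_antisymd m w) (uncontract_antisymu m w)
  (fun J t h => (uncontract_size h).2) Ik Is).
have Isu : uniq (I ++ s) by rewrite (perm_uniq Is) enum_uniq.
have Isn : size (I ++ s) = n by rewrite (perm_size Is) size_enum_ord.
rewrite /uncontract (sum_tuple_perm
  (g := fun J => volume (I ++ J) * volume (I ++ s) * w J) su sm).
- rewrite mulKf ?pnatr_eq0 -?lt0n ?fact_gt0//.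
  by rewrite volume_sqr// mul1r.
- move=> J Jm; apply: contraNeq; rewrite !mulf_eq0 !negb_or -andbA.
  move=> /and3P[/volume_perm IJ _ _]; rewrite -(perm_cat2l I).
  by rewrite (perm_trans IJ)// perm_sym.
move=> J Js; rewrite mulrAC.
by rewrite (antisym_mul_perm (antisym_catl I volume_antisym) wA Js) mulrAC.
Qed.

End Antisymmetric.

(** * The intertwining relation as pointwise multilinear algebra *)

Section ContractionIdentity.
Context {R : realType} {n : nat}.
Local Notation C := (cplx R).
Local Opaque cplx.
Implicit Types (a b c d : 'I_n) (s t I J L : seq 'I_n).
Variable k : nat.
(* q is the bivector, B c its derivatives, v the tensor to be contracted and
   Dv c its derivatives. *)
Variables (q : 'I_n -> 'I_n -> C) (B : 'I_n -> 'I_n -> 'I_n -> C).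
Variables (v : seq 'I_n -> seq 'I_n -> C) (Dv : 'I_n -> seq 'I_n -> seq 'I_n -> C).
Hypothesis qA : forall a b, q a b = - q b a.
Hypothesis BA : forall c a b, B c a b = - B c b a.
Hypothesis vA : forall J, antisym (v J).
Hypothesis vA' : forall t, antisym (v^~ t).
Hypothesis vn : forall J t, v J t != 0 -> size t = n.
Hypothesis DvA : forall c J, antisym (Dv c J).

Let w t := (k`!%:R)^-1 * \sum_(J : k.-tuple 'I_n) v J (J ++ t).
Let Dw c t := (k`!%:R)^-1 * \sum_(J : k.-tuple 'I_n) Dv c J (J ++ t).
(** What remains of the bracket term after both extractions. The factor [k%:R] comes from the second
    one; for k = 0 it kills the term, [k.-1] being then a default value. *)
Let N c b a s : C := (k`!%:R)^-1 *
  (k%:R * \sum_(L : k.-1.-tuple 'I_n) v (c :: L) (b :: a :: L ++ s)).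

Lemma contract_front (u : seq 'I_n -> seq 'I_n -> C) a s :
  (forall J, antisym (u J)) ->
  \sum_(J : k.-tuple 'I_n) u J (a :: J ++ s) =
  (-1) ^+ k * \sum_(J : k.-tuple 'I_n) u J (J ++ a :: s).
Proof.
move=> uA; rewrite mulr_sumr; apply: eq_bigr => J _.
have := antisym_move [::] J a s (uA J).
by rewrite /= size_tuple => ->; rewrite signrMK.
Qed.

(** Evaluate dx^c /\ v J = 0 on [J ++ [:: a, b & s]] and sum over [J]: taking out a letter of [J]
    yields [N] up to sign, taking out [a], [b] or a letter of [s] yields the right-hand side, with
    (-1)^k for passing over [J]. *)
Lemma contract_insert c b a s :
  N c b a s = (-1) ^+ k * ((a == c)%:R * w (b :: s) - (b == c)%:R * w (a :: s) +
    altsum (fun d t => (d == c)%:R * w [:: a, b & t]) s).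
Proof.
pose g J := altsum (fun d t => (d == c)%:R * v J t) (J ++ [:: a, b & s]).
have g0 : \sum_(J : k.-tuple 'I_n) g J = 0.
  by rewrite big1// => J _; exact: (altsum_top c _ (vA J) (@vn J)).
have gE : \sum_(J : k.-tuple 'I_n) g J =
  k%:R * \sum_(L : k.-1.-tuple 'I_n) v (c :: L) (L ++ [:: a, b & s]) +
  (-1) ^+ k * \sum_(J : k.-tuple 'I_n) ((a == c)%:R * v J (J ++ b :: s) -
   (b == c)%:R * v J (J ++ a :: s) +
   altsum (fun d t => (d == c)%:R * v J (J ++ [:: a, b & t])) s).
  transitivity (\sum_(J : k.-tuple 'I_n)
      (altsum (fun d L => (d == c)%:R * v J (L ++ [:: a, b & s])) J +
      (-1) ^+ k * ((a == c)%:R * v J (J ++ b :: s) -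
   (b == c)%:R * v J (J ++ a :: s) +
   altsum (fun d t => (d == c)%:R * v J (J ++ [:: a, b & t])) s))).
    by apply: eq_bigr => J _; rewrite /g altsum_cat altsum_cons2 size_tuple.
  rewrite big_split /=; congr (_ + _); last by rewrite mulr_sumr.
  rewrite (sum_altsum _ (F := fun d L I => (d == c)%:R * v I (L ++ [:: a, b & s]))).
    congr (_ * _); rewrite (bigD1 c)//= [X in _ + X]big1 ?addr0; last first.
      by move=> d /negPf dc; rewrite big1// => L _; rewrite dc mul0r.
    by apply: eq_bigr => L _; rewrite eqxx mul1r.
  by move=> d J r e f t; rewrite vA' mulrN.
(* Both [a] and [b] pass over [L], at a sign that squares to 1; the minus sign comes from exchanging
   them. *)
have NE : N c b a s = - ((k`!%:R)^-1 *
    (k%:R * \sum_(L : k.-1.-tuple 'I_n) v (c :: L) (L ++ [:: a, b & s]))).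
  rewrite /N -mulrN -[in RHS]mulrN -sumrN; congr (_ * (_ * _)); apply: eq_bigr => L _.
  have := antisym_move [::] L a (b :: s) (vA (c :: L)).
  have := antisym_move [:: a] L b s (vA (c :: L)).
  rewrite /= => -> ->.
  by rewrite mulrA -expr2 sqrr_sign mul1r (vA _ [::]).
rewrite NE; move: g0; rewrite gE => /eqP; rewrite addr_eq0 => /eqP ->.
rewrite mulrN opprK mulrCA; congr (_ * _).
rewrite big_split sumrB /= -!mulr_sumr -altsum_sum mulrDr mulrBr; congr (_ - _ + _).
- by rewrite mulrCA.
- by rewrite mulrCA.
rewrite -altsumZ; apply: eq_altsum => d t.
by rewrite -mulr_sumr mulrCA.
Qed.

(** The trace terms [S2] (the divergence of the bivector) coming from the representation cancel
    those that [contract_insert] splits off from the bracket term. There survive [S1] and half of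
    [Z], the two parts of i_pi d - d i_pi in a chart. *)
Lemma contract_identity s :
  (k.+1`!%:R)^-1 * \sum_(I : k.+1.-tuple 'I_n)
    (altsum (fun a J => \sum_c q a c * Dv c J (I ++ s) +
       (\sum_c B c a c) * v J (I ++ s)) I +
     2^-1 * altsum (fun b J => altsum (fun a L =>
       \sum_c B c a b * v (c :: L) (I ++ s)) J) I) =
  (-1) ^+ k.+1 * (\sum_a \sum_b q a b * Dw a (b :: s) -
    2^-1 * altsum (fun d t => \sum_a \sum_b B d a b * w [:: a, b & t]) s).
Proof.
have kS : (k.+1`!%:R)^-1 * k.+1%:R = (k`!%:R)^-1 :> C.
  by rewrite factS natrM invfM mulrAC mulVf ?mul1r// pnatr_eq0.
pose S1 := \sum_a \sum_c q a c * Dw c (a :: s).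
pose S2 := \sum_a \sum_c B c a c * w (a :: s).
pose Z := altsum (fun d t => \sum_a \sum_b B d a b * w [:: a, b & t]) s.
have T1 : (k.+1`!%:R)^-1 * \sum_(I : k.+1.-tuple 'I_n)
    altsum (fun a J => \sum_c q a c * Dv c J (I ++ s) +
      (\sum_c B c a c) * v J (I ++ s)) I = (-1) ^+ k * (S1 + S2).
  rewrite (sum_altsum _ (F := fun a J t => \sum_c q a c * Dv c J (t ++ s) +
      (\sum_c B c a c) * v J (t ++ s))); last first.
    move=> a J r e f t; rewrite -!catA /= vA mulrN opprD -sumrN; congr (_ + _).
    by apply: eq_bigr => c _; rewrite DvA mulrN.
  rewrite mulrA kS /S1 /S2 -big_split mulr_sumr mulr_sumr.
  apply: eq_bigr => a _ /=; rewrite big_split /= !mulrDr; congr (_ + _).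
    rewrite exchange_big !mulr_sumr; apply: eq_bigr => c _ /=.
    rewrite -mulr_sumr (contract_front a s (DvA c)) /Dw.
    by rewrite mulrCA [in RHS]mulrCA; congr (_ * _); rewrite mulrCA.
  rewrite -mulr_sumr (contract_front a s vA) -mulr_suml /w.
  by rewrite mulrCA [in RHS]mulrCA; congr (_ * _); rewrite mulrCA.
have T2 : (k.+1`!%:R)^-1 * \sum_(I : k.+1.-tuple 'I_n)
    altsum (fun b J => altsum (fun a L =>
      \sum_c B c a b * v (c :: L) (I ++ s)) J) I = (-1) ^+ k * (Z - 2 * S2).
  rewrite (sum_altsum _ (F := fun b J t => altsum (fun a L =>
      \sum_c B c a b * v (c :: L) (t ++ s)) J)); last first.
    move=> b J r e f t; rewrite -altsumN; apply: eq_altsum => a L.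
    by rewrite -sumrN; apply: eq_bigr => c _; rewrite -!catA /= vA mulrN.
  rewrite mulrA kS.
  transitivity (\sum_b \sum_a \sum_c B c a b * N c b a s).
    rewrite mulr_sumr; apply: eq_bigr => b _.
    rewrite (sum_altsum _ (F := fun a L t =>
      \sum_c B c a b * v (c :: L) (b :: t ++ s))); last first.
      move=> a J r e f t; rewrite -sumrN; apply: eq_bigr => c _.
      by rewrite -!catA /= -!cat_cons vA mulrN.
    rewrite !mulr_sumr; apply: eq_bigr => a _.
    rewrite exchange_big !mulr_sumr; apply: eq_bigr => c _ /=.
    by rewrite -mulr_sumr /N (mulrCA k%:R (B c a b)) (mulrCA _ (B c a b)).
  transitivity ((-1) ^+ k * \sum_b \sum_a \sum_c (
      B c a b * (a == c)%:R * w (b :: s) - B c a b * (b == c)%:R * w (a :: s) +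
      B c a b * altsum (fun d t => (d == c)%:R * w [:: a, b & t]) s)).
    rewrite mulr_sumr; apply: eq_bigr => b _; rewrite mulr_sumr; apply: eq_bigr => a _.
    rewrite mulr_sumr; apply: eq_bigr => c _; rewrite contract_insert.
    by rewrite mulrCA mulrDr mulrBr !mulrA.
  congr (_ * _).
  have -> : Z = \sum_b \sum_a \sum_c
      B c a b * altsum (fun d t => (d == c)%:R * w [:: a, b & t]) s.
    rewrite /Z (@eq_altsum _ _ _ (fun d t => \sum_b \sum_a \sum_c
        B c a b * ((d == c)%:R * w [:: a, b & t]))).
      rewrite altsum_sum; apply: eq_bigr => b _.
      rewrite altsum_sum; apply: eq_bigr => a _.
      by rewrite altsum_sum; apply: eq_bigr => c _; rewrite altsumZ.
    move=> d t; rewrite exchange_big; apply: eq_bigr => b _; apply: eq_bigr => a _.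
    rewrite (bigD1 d)//= eqxx mul1r big1 ?addr0// => c /negPf cd.
    by rewrite eq_sym cd mul0r mulr0.
  have -> : 2 * S2 = \sum_b \sum_a \sum_c
      (B c a b * (b == c)%:R * w (a :: s) - B c a b * (a == c)%:R * w (b :: s)).
    (* [S2] is written once with each of the two Kronecker symbols, the second time through the
       antisymmetry of [B], to match the two trace terms. *)
    have S2E : S2 = \sum_b \sum_a \sum_c B c a b * (b == c)%:R * w (a :: s).
      rewrite /S2 exchange_big; apply: eq_bigr => b _; apply: eq_bigr => a _.
      rewrite (bigD1 b)//= eqxx mulr1 big1 ?addr0// => c /negPf cb.
      by rewrite eq_sym cb mulr0 mul0r.
    have S2N : S2 = - \sum_b \sum_a \sum_c B c a b * (a == c)%:R * w (b :: s).
      rewrite -sumrN; apply: eq_bigr => b _; rewrite -sumrN; apply: eq_bigr => a _.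
      rewrite (bigD1 a)//= [X in _ + X]big1 ?addr0; last first.
        by move=> c /negPf ca; rewrite eq_sym ca mulr0 mul0r.
      by rewrite eqxx mulr1 (BA a a b) mulNr opprK.
    rewrite mulr2n mulrDl mul1r {1}S2E S2N -sumrB; apply: eq_bigr => b _.
    by rewrite -sumrB; apply: eq_bigr => a _; rewrite -sumrB.
  rewrite -sumrB; apply: eq_bigr => b _; rewrite -sumrB; apply: eq_bigr => a _.
  by rewrite -sumrB; apply: eq_bigr => c _; ring.
have RS : \sum_a \sum_b q a b * Dw a (b :: s) = - S1.
  rewrite /S1 exchange_big -sumrN; apply: eq_bigr => a _.
  by rewrite -sumrN; apply: eq_bigr => b _; rewrite qA mulNr.
rewrite big_split /= mulrDr T1 -mulr_sumr mulrCA T2 RS -/Z exprS.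
by field.
Qed.

End ContractionIdentity.

(** * Contraction under a change of frame *)

Section ChangeOfFrame.
Context {R : realType} {n : nat}.
Local Notation C := (cplx R).
Local Opaque cplx.
Implicit Types (a b c : 'I_n) (s t I J : seq 'I_n) (u : seq 'I_n -> C).
Implicit Types (A B : 'I_n -> 'I_n -> C).

Definition pull B u s : C :=
  \sum_(t : (size s).-tuple 'I_n) u t * \prod_(e <- zip s t) B e.1 e.2.

Lemma pull_nil B u : pull B u [::] = u [::].
Proof.
rewrite /pull (sum_tuple0 (fun t => u t * \prod_(e <- zip [::] t) B e.1 e.2)).
by rewrite big_nil mulr1.
Qed.

Lemma pull_cons B u a s :
  pull B u (a :: s) = \sum_b B a b * pull B (fun t => u (b :: t)) s.
Proof.
rewrite /pull /= (sum_tuple_cons (size s)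
  (fun t => u t * \prod_(e <- zip (a :: s) t) B e.1 e.2)).
apply: eq_bigr => b _; rewrite mulr_sumr; apply: eq_bigr => t _ /=.
by rewrite big_cons mulrCA.
Qed.

Lemma eq_pull B u v s : u =1 v -> pull B u s = pull B v s.
Proof. by move=> uv; apply: eq_bigr => t _; rewrite uv. Qed.

Lemma pullZ B k u s : pull B (fun t => k * u t) s = k * pull B u s.
Proof. by rewrite /pull mulr_sumr; apply: eq_bigr => t _; rewrite mulrA. Qed.

Lemma pullN B u s : pull B (fun t => - u t) s = - pull B u s.
Proof. by rewrite /pull -sumrN; apply: eq_bigr => t _; rewrite mulNr. Qed.

Lemma pull_sum B (T : finType) (F : T -> seq 'I_n -> C) s :
  pull B (fun t => \sum_i F i t) s = \sum_i pull B (F i) s.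
Proof.
rewrite /pull [RHS]exchange_big; apply: eq_bigr => t _ /=.
by rewrite mulr_suml.
Qed.

Lemma pull_antisym B u : antisym u -> antisym (pull B u).
Proof.
move=> uA s a b t; elim: s u uA => [|e s IH] u uA /=.
  rewrite (pull_cons B u a) (pull_cons B u b).
  under eq_bigr do rewrite pull_cons mulr_sumr.
  under [in RHS]eq_bigr do rewrite pull_cons mulr_sumr.
  rewrite exchange_big -sumrN; apply: eq_bigr => c _; rewrite -sumrN.
  apply: eq_bigr => d _ /=.
  rewrite (@eq_pull _ _ (fun r => - u [:: c, d & r])); last first.
    by move=> r; exact: (uA [::]).
  by rewrite pullN !mulrN mulrCA.
rewrite !pull_cons -sumrN; apply: eq_bigr => c _.
by rewrite IH ?mulrN//; exact: (antisym_catl [:: c]).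
Qed.

(** Shaped so as to be convertible to the right-hand side of the transition law [ts_change] when [A]
    and [B] are the two Jacobians. *)
Definition change_frame A B (v : seq 'I_n -> seq 'I_n -> C) I s : C :=
  \sum_(J : (size I).-tuple 'I_n) \sum_(t : (size s).-tuple 'I_n)
    v J t * \prod_(e <- zip I J) A e.2 e.1 * \prod_(e <- zip s t) B e.1 e.2.

Lemma change_frameE A B v I s :
  change_frame A B v I s = pull (fun a b => A b a) (fun J => pull B (v J) s) I.
Proof.
apply: eq_bigr => J _; rewrite /pull mulr_suml; apply: eq_bigr => t _.
by rewrite mulrAC.
Qed.

Lemma change_frame_antisymu A B v s : (forall t, antisym (v^~ t)) ->
  antisym (change_frame A B v ^~ s).
Proof.
move=> vA r a b t; rewrite !change_frameE; apply: pull_antisym => {}r {}a {}b {}t.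
rewrite -pullN; apply: eq_pull => s'; exact: vA.
Qed.

Lemma change_frame_antisymd A B v I : (forall J, antisym (v J)) ->
  antisym (change_frame A B v I).
Proof.
move=> vA r a b t; rewrite !change_frameE -pullN; apply: eq_pull => J.
exact: pull_antisym.
Qed.

Lemma change_frame_size A B v I s p q :
  (forall J t, v J t != 0 -> size J = p /\ size t = q) ->
  change_frame A B v I s != 0 -> size I = p /\ size s = q.
Proof.
move=> vpq; apply: contra_neqP => Is; rewrite /change_frame big1// => J _.
rewrite big1// => t _; suff -> : v J t = 0 by rewrite !mul0r.
apply/eqP; apply: contraT => /vpq[]; rewrite !size_tuple => Ip sq.
by case: Is.
Qed.

(** Induction on the number of contracted pairs: summing over one common index brings [A] and [B]
    together, and their product is the identity. *)
Lemma contract_change_frame A B v k s :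
  (forall a c, \sum_b A a b * B b c = (a == c)%:R) ->
  \sum_(I : k.-tuple 'I_n) change_frame A B v I (I ++ s) =
  pull B (fun t => \sum_(I : k.-tuple 'I_n) v I (I ++ t)) s.
Proof.
move=> AB; under eq_bigr do rewrite change_frameE.
elim: k v => [|k IH] v.
  rewrite (sum_tuple0 (fun I => pull _ (fun J => pull B (v J) (I ++ s)) I)).
  rewrite pull_nil; apply: eq_pull => t.
  by rewrite (sum_tuple0 (fun I => v I (I ++ t))).
rewrite (sum_tuple_cons k (fun I => pull _ (fun J => pull B (v J) (I ++ s)) I)).
transitivity (\sum_a \sum_(J : k.-tuple 'I_n) \sum_b \sum_c A b a * B a c *
    pull (fun a b => A b a) (fun L => pull B (fun t => v (b :: L) (c :: t)) (J ++ s)) J).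
  apply: eq_bigr => a _; apply: eq_bigr => J _; rewrite pull_cons.
  apply: eq_bigr => b _; rewrite (@eq_pull _ _ (fun L => \sum_c B a c *
    pull B (fun t => v (b :: L) (c :: t)) (J ++ s))); last first.
    by move=> L; rewrite cat_cons pull_cons.
  rewrite pull_sum mulr_sumr; apply: eq_bigr => c _.
  by rewrite pullZ mulrA.
transitivity (\sum_b \sum_(J : k.-tuple 'I_n)
    pull (fun a b => A b a) (fun L => pull B (fun t => v (b :: L) (b :: t)) (J ++ s)) J).
  rewrite exchange_big [RHS]exchange_big; apply: eq_bigr => J _ /=.
  rewrite exchange_big; apply: eq_bigr => b _ /=.
  rewrite exchange_big (bigD1 b)//= [X in _ + X]big1 ?addr0.
    by rewrite -mulr_suml AB eqxx mul1r.
  by move=> c /negPf cb; rewrite -mulr_suml AB eq_sym cb mul0r.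
rewrite (@eq_pull _ _ (fun t => \sum_b \sum_(J : k.-tuple 'I_n) v (b :: J) (b :: J ++ t))).
  rewrite pull_sum; apply: eq_bigr => b _.
  exact: (IH (fun J t => v (b :: J) (b :: t))).
by move=> t; rewrite (sum_tuple_cons k (fun I => v I (I ++ t))).
Qed.

End ChangeOfFrame.

(** * Maps between hypercohomology groups *)

Lemma rem_at_rcons (T : Type) p (s : seq T) y : (p < size s)%N ->
  rem_at p (rcons s y) = rcons (rem_at p s) y.
Proof.
move=> ps; rewrite /rem_at drop_rcons// -[in take _ _]cats1.
by rewrite takel_cat 1?ltnW// rcons_cat.
Qed.

Lemma rem_at_rcons_last (T : Type) (s : seq T) y :
  rem_at (size s) (rcons s y) = s.
Proof.
by rewrite /rem_at -cats1 take_size_cat// drop_oversize ?cats0// size_cat addn1.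
Qed.

Section HypercohomologyMap.
Local Open Scope classical_set_scope.
Local Open Scope quotient_scope.
Context {K : fieldType} {X : topologicalType} {V : lmodType K}.

Lemma sheaf_dif0 (F : sheaf_complex X V) q z : dif F q 0 z = 0.
Proof.
have s0 := sec_zero F q setT.
have := @dif_lin _ _ _ F q setT (-1) _ _ openT s0 s0 z (mem_set Logic.I).
rewrite scaler0 add0r => ->.
by rewrite [LHS](_ : _ = -1 *: dif F q 0 z + dif F q 0 z) // scaleN1r addNr.
Qed.

Lemma hvalidB (F : sheaf_complex X V) m b c :
  hvalid F m b -> hvalid F m c -> hvalid F m (b - c).
Proof.
by move=> bv cv; rewrite -[- c]scaleN1r addrC; exact: hvalid_lin.
Qed.

Lemma hdifB (F : sheaf_complex X V) m b c w y :
  hvalid F m b -> hvalid F m c -> \forall z \near y,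
  hdif F m (b - c) (rcons w y) z =
  hdif F m b (rcons w y) z - hdif F m c (rcons w y) z.
Proof.
move=> bv cv; rewrite -[- c]scaleN1r addrC.
by apply: filterS (hdif_lin (-1) w y cv bv) => z ->; rewrite scaleN1r addrC.
Qed.

(* P w z holds for w = x0 ... xp when xp is close to x(p-1), and z to xp. *)
Definition hnear (P : seq X -> X -> Prop) : Prop :=
  (forall x, \forall z \near x, P [:: x] z) /\
  forall w x, \forall y \near x, \forall z \near y, P (rcons (rcons w x) y) z.

Lemma hnearW (P : seq X -> X -> Prop) :
  (forall w y, \forall z \near y, P (rcons w y) z) -> hnear P.
Proof.
move=> PP; split=> [x|w x]; first exact: (PP [::] x).
by near=> y; exact: PP.
Unshelve. all: by end_near. Qed.

Lemma hnearS2 (P Q S : seq X -> X -> Prop) :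
  (forall w z, P w z -> Q w z -> S w z) -> hnear P -> hnear Q -> hnear S.
Proof.
move=> PQS [P1 P2] [Q1 Q2]; split=> [x|w x].
  by apply: filterS2 (P1 x) (Q1 x) => z; exact: PQS.
apply: filterS2 (P2 w x) (Q2 w x) => y; apply: filterS2 => z; exact: PQS.
Qed.

Lemma hnearS (P Q : seq X -> X -> Prop) :
  (forall w z, P w z -> Q w z) -> hnear P -> hnear Q.
Proof. by move=> PQ PP; apply: (hnearS2 _ PP PP) => w z /PQ. Qed.

(** Reduces the comparison of families to arithmetic of values at one point. [hnear] constrains only
    the last two nearness conditions; the induction on [p] freezes the leading points until these
    two are left. *)
Lemma hnull_imp (c d : hcochain X V) :
  hnear (fun w z => c w z = 0 -> d w z = 0) -> hnull c -> hnull d.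
Proof.
move=> [cd1 cd2] c0 [|p] x; first by apply: filterS2 (cd1 x) (c0 0 x) => z.
have {}c0 := c0 p.+1 x; clear cd1; move: c0; elim: p x c d cd2 => [|p IH] x c d cd.
  apply: filterS2 (cd [::] x) => y; by apply: filterS2.
apply: filterS => y; apply: (IH y (fun w => c (x :: w)) (fun w => d (x :: w))).
by move=> w; exact: (cd (x :: w)).
Qed.

Lemma hnull_hnear (c : hcochain X V) : hnear (fun w z => c w z = 0) -> hnull c.
Proof.
move=> c0; apply: (@hnull_imp 0 c); last exact: hnull0.
exact: hnearS c0.
Qed.

Lemma hnull_lin (a : K) (c d : hcochain X V) :
  hnull c -> hnull d -> hnull (a *: c + d).
Proof.
move=> c0 d0 p x; apply: (@hvanish_lin _ _ _ a c d) => // w y.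
by near=> z.
Unshelve. all: by end_near. Qed.

Lemma hvalid_near (F : sheaf_complex X V) m c w y : hvalid F m c ->
  exists U, [/\ open U, U y & sec F (m - (size w)%:Z) U (c (rcons w y))].
Proof.
case=> _ cP; case: w => [|x w]; first exact: (cP y [::]).
have [U [Uo Uy cU]] := cP x (rcons w y).
by rewrite last_rcons size_rcons in Uy cU; exists U.
Qed.

Lemma hdifE (F : sheaf_complex X V) m c w z :
  hdif F m c w z = \sum_(p < size w) (-1) ^+ p *: c (rem_at p w) z +
    (-1) ^+ (size w).-1 *: dif F (m - ((size w).-1)%:Z) (c w) z.
Proof.
rewrite [LHS](_ : _ = (\sum_(p < size w) (-1) ^+ p *: c (rem_at p w)) z +
  (-1) ^+ (size w).-1 *: dif F (m - ((size w).-1)%:Z) (c w) z) //.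
by rewrite fct_sumE.
Qed.

(** [P] is abstract because it serves both for vanishing and for membership in [good]. It must hold
    of 0 since a one-point word loses its only letter and [c [::] = 0]. *)
Lemma hnear_rem (F : sheaf_complex X V) m (c : hcochain X V)
    (P : int -> X -> V -> Prop) :
  (forall q z, P q z 0) ->
  hvalid F m c ->
  (forall w y, \forall z \near y, P (m - (size w)%:Z) z (c (rcons w y) z)) ->
  hnear (fun w z => forall p, (p < size w)%N ->
    P (m + 1 - (size w).-1%:Z) z (c (rem_at p w) z)).
Proof.
move=> P0 [c0 _] cP; split=> [x|w x].
  near=> z => -[] // _; rewrite /rem_at /= c0.
  exact: P0.
have : nbhs x (fun y => P (m - (size w)%:Z) y (c (rcons w x) y)) := cP w x.
(* Deleting the last point leaves a germ at [x]; what holds near [x] also holds near every [y] close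
   enough to [x]. *)
move=> /nbhs_interior; apply: filterS => y wy.
have : \forall z \near y, forall p : 'I_(size w).+2,
    P (m - (size w)%:Z) z (c (rem_at p (rcons (rcons w x) y)) z).
  apply: filter_forall => -[p /=]; rewrite ltnS leq_eqVlt => /orP[/eqP ->|pw].
    by rewrite -(size_rcons w x) rem_at_rcons_last; exact: wy.
  rewrite rem_at_rcons ?size_rcons//.
  suff -> : size w = size (rem_at p (rcons w x)) by exact: cP.
  rewrite /rem_at size_cat size_take size_drop size_rcons pw subSS subnKC//.
apply: filterS => z Pz p; rewrite !size_rcons => pw.
rewrite [m + 1 - _](_ : _ = m - (size w)%:Z); first exact: (Pz (Ordinal pw)).
by rewrite /= intS opprD addrA addrK.
Unshelve. all: by end_near. Qed.

(* The last term c(x0, ..., x(p-1)) of the differential is only known to vanish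
   near x(p-1), hence the need for xp to be close to it. *)
Lemma hnull_hdif (F : sheaf_complex X V) m (c : hcochain X V) : hvalid F m c ->
  (forall w y, \forall z \near y, c (rcons w y) z = 0) -> hnull (hdif F m c).
Proof.
move=> cv c0; apply: hnull_hnear.
have dif0 w y : \forall z \near y, dif F (m - (size w)%:Z) (c (rcons w y)) z = 0.
  have : nbhs y (fun z => c (rcons w y) z = 0) := c0 w y.
  rewrite nbhsE => -[W [Wo Wy] WP].
  have cW : {in W, c (rcons w y) =1 0} by move=> u /set_mem /WP.
  have : \forall z \near y, W z by exact: open_nbhs_nbhs.
  apply: filterS => z Wz.
  rewrite (@dif_loc _ _ _ F (m - (size w)%:Z) W _ _ Wo cW z (mem_set Wz)).
  exact: sheaf_dif0.
have dif0' : hnear (fun w z => dif F (m - (size w).-1%:Z) (c w) z = 0).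
  by apply: hnearW => w y; rewrite size_rcons; exact: dif0.
have crem := @hnear_rem F m c (fun _ _ v => v = 0) (fun _ _ => erefl) cv c0.
apply: (hnearS2 _ dif0' crem) => w z dz cz.
rewrite hdifE dz scaler0 addr0 big1// => p _.
by rewrite cz ?scaler0.
Qed.

(** * Isomorphism on hypercohomology from a morphism that is injective on values *)

Variables F G : sheaf_complex X V.
Variable phi : int -> (X -> V) -> X -> V.
Variable psi : int -> (X -> V) -> X -> V.
Variable good : int -> V -> Prop.
Hypothesis phi_lin : forall k a f g, phi k (a *: f + g) = a *: phi k f + phi k g.
Hypothesis phi_ker : forall k (f : X -> V) x, f x = 0 -> phi k f x = 0.
Hypothesis phi_sec : forall k U f, open U -> sec F k U f -> sec G k U (phi k f).
Hypothesis phi_dif : forall k U f x, open U -> U x -> sec F k U f ->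
  phi (k + 1) (dif F k f) x = dif G k (phi k f) x.
Hypothesis psi_sec : forall k U g, open U -> sec G k U g -> sec F k U (psi k g).
Hypothesis psiK : forall k U g x, open U -> U x -> sec G k U g ->
  phi k (psi k g) x = g x.
Hypothesis good0 : forall k, good k 0.
Hypothesis good_lin : forall k (a : K) u v, good k u -> good k v ->
  good k (a *: u + v).
Hypothesis good_sec : forall k U f x, open U -> U x -> sec F k U f -> good k (f x).
Hypothesis good_dif : forall k U f x, open U -> U x -> sec F k U f ->
  good (k + 1) (dif F k f x).
Hypothesis phi_inj : forall k (f : X -> V) x, good k (f x) ->
  phi k f x = 0 -> f x = 0.

Definition hmap (f : int -> (X -> V) -> X -> V) m (c : hcochain X V) :
  hcochain X V := fun w => f (m - (size w).-1%:Z) (c w).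

Lemma hmap_lin m a c d :
  hmap phi m (a *: c + d) = a *: hmap phi m c + hmap phi m d.
Proof. by apply/funext => w; exact: phi_lin. Qed.

Lemma hmapB m c d : hmap phi m (c - d) = hmap phi m c - hmap phi m d.
Proof. by rewrite -[- d]scaleN1r addrC hmap_lin scaleN1r addrC. Qed.

Lemma phi0 k : phi k 0 = 0.
Proof. by apply/funext => x; exact: phi_ker. Qed.

Lemma hmap_valid m c : hvalid F m c -> hvalid G m (hmap phi m c).
Proof.
case=> c0 cP; split; first by rewrite /hmap c0 phi0.
by move=> x w; have [U [Uo Ux cU]] := cP x w; exists U; split => //; exact: phi_sec.
Qed.

Lemma phi_sum k z N (s : 'I_N -> K) (f : 'I_N -> X -> V) g :
  phi k (\sum_(p < N) s p *: f p + g) z =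
  \sum_(p < N) s p *: phi k (f p) z + phi k g z.
Proof.
elim: N s f g => [|N IH] s f g; first by rewrite !big_ord0 !add0r.
rewrite !big_ord_recl -!addrA phi_lin -(IH (fun p => s (lift ord0 p))) //.
Qed.

Lemma hmap_dif m c w y : hvalid F m c -> \forall z \near y,
  hdif G m (hmap phi m c) (rcons w y) z = hmap phi (m + 1) (hdif F m c) (rcons w y) z.
Proof.
move=> cv; have [U [Uo Uy cU]] := hvalid_near w y cv.
have : \forall z \near y, U z by exact: open_nbhs_nbhs.
apply: filterS => z Uz; rewrite hdifE /hmap /hdif -[X in phi _ (_ + X)]addr0.
rewrite phi_sum phi_lin phi0 addr0.
rewrite [X in _ = _ + X](_ : _ = (-1) ^+ (size (rcons w y)).-1 *:
  phi (m + 1 - (size (rcons w y)).-1%:Z)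
    (dif F (m - ((size (rcons w y)).-1)%:Z) (c (rcons w y))) z) //.
congr (_ + _).
  apply: eq_bigr => p _; congr (_ *: _).
  (* From a one-point word only the empty word is left, where the truncated [(size w).-1] miscounts
     the degree; both sides are 0 there. *)
  case: w p {U Uo Uy cU Uz} => [|x w] p.
    have -> : rem_at p (rcons [::] y) = [::] by case: p => -[].
    by rewrite cv.1 !phi0.
  suff -> : (m - (size (rem_at p (rcons (x :: w) y))).-1%:Z =
    m + 1 - (size (rcons (x :: w) y)).-1%:Z) by [].
  case: p => p /= pw; rewrite /rem_at size_cat size_take size_drop /= pw.
  by move: pw; rewrite !size_rcons; lia.
congr (_ *: _); rewrite size_rcons /= in cU *.
by rewrite addrAC; apply/esym; exact: phi_dif cU.
Qed.

Lemma good_sum k N (s : 'I_N -> K) (f : 'I_N -> V) v :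
  (forall p, good k (f p)) -> good k v -> good k (\sum_(p < N) s p *: f p + v).
Proof.
elim: N s f v => [|N IH] s f v fg vg; first by rewrite big_ord0 add0r.
by rewrite big_ord_recl -addrA; apply: good_lin => //; exact: IH.
Qed.

Lemma good_hdif m c : hvalid F m c ->
  hnear (fun w z => good (m + 1 - (size w).-1%:Z) (hdif F m c w z)).
Proof.
move=> cv.
have cg w y : \forall z \near y, good (m - (size w)%:Z) (c (rcons w y) z).
  have [U [Uo Uy cU]] := hvalid_near w y cv.
  have : \forall z \near y, U z by exact: open_nbhs_nbhs.
  by apply: filterS => z Uz; exact: (good_sec Uo Uz cU).
have dg : hnear (fun w z => good (m + 1 - (size w).-1%:Z)
    (dif F (m - (size w).-1%:Z) (c w) z)).
  apply: hnearW => w y; rewrite size_rcons /=.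
  have [U [Uo Uy cU]] := hvalid_near w y cv.
  have : \forall z \near y, U z by exact: open_nbhs_nbhs.
  by apply: filterS => z Uz; rewrite addrAC; exact: (good_dif Uo Uz cU).
have crem := @hnear_rem F m c (fun q _ v => good q v) (fun q _ => good0 q) cv cg.
apply: (hnearS2 _ dg crem) => w z {}dg cgr.
rewrite hdifE; apply: good_sum => [p|]; first by apply: cgr; exact: ltn_ord.
by rewrite -[_ *: _]addr0; exact: good_lin.
Qed.

Lemma hmap_dif_near m c : hvalid F m c ->
  hnear (fun w z => hdif G m (hmap phi m c) w z = hmap phi (m + 1) (hdif F m c) w z).
Proof. by move=> cv; apply: hnearW => w y; exact: hmap_dif. Qed.

Lemma hmap_null m c : hnull c -> hnull (hmap phi m c).
Proof.
by apply: hnull_imp; apply: hnearW => w y; near=> z; exact: phi_ker.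
Unshelve. all: by end_near. Qed.

Lemma hnull_eq (c d : hcochain X V) :
  hnear (fun w z => c w z = d w z) -> hnull c -> hnull d.
Proof. by move=> cd; apply: hnull_imp; apply: hnearS cd => w z ->. Qed.

Lemma hmap_cocycle m c : hcocycle F m c -> hcocycle G m (hmap phi m c).
Proof.
move=> [cv c0]; split; first exact: hmap_valid.
apply: hnull_eq (hmap_null (m + 1) c0).
by apply: hnearS (hmap_dif_near cv) => w z ->.
Qed.

Lemma hmap_cobord m c : hcobord F m c -> hcobord G m (hmap phi m c).
Proof.
move=> [b bv cb]; exists (hmap phi (m - 1) b); first exact: hmap_valid.
apply: hnull_eq (hmap_null m cb).
apply: hnearS (hmap_dif_near bv) => w z E.
rewrite [RHS](_ : _ = hmap phi m c w z - hdif G (m - 1) (hmap phi (m - 1) b) w z) //.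
by rewrite E subrK hmapB.
Qed.

(** The difference vanishes near the last point of every word, which is stronger than [hnull] and is
    what [hnull_hdif] requires. *)
Lemma hmap_psi_valid m c : hvalid G m c -> exists b, [/\ hvalid F m b,
  hvalid G m (hmap phi m b) &
  forall w y, \forall z \near y, (c - hmap phi m b) (rcons w y) z = 0].
Proof.
move=> [c0 cP].
(* Validity demands 0 on the empty word, and [psi] need not send 0 to 0. *)
pose b : hcochain X V := fun w => if w is [::] then 0 else hmap psi m c w.
have bv : hvalid F m b.
  split=> // x w; have [U [Uo Ux cU]] := cP x w; exists U; split=> //.
  exact: psi_sec.
exists b; split=> //; first exact: hmap_valid.
move=> w y; have [U [Uo Uy cU]] := hvalid_near w y (conj c0 cP).
have : \forall z \near y, U z by exact: open_nbhs_nbhs.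
apply: filterS => z Uz.
rewrite [LHS](_ : _ = c (rcons w y) z - hmap phi m b (rcons w y) z) //.
have -> : hmap phi m b (rcons w y) z = c (rcons w y) z; last by rewrite subrr.
rewrite /hmap size_rcons [b _](_ : _ = psi (m - (size w)%:Z) (c (rcons w y))).
  exact: (psiK Uo Uz cU).
by rewrite /b; case: w {Uo Uy cU Uz} => [|x w] //=; rewrite /hmap /= size_rcons.
Qed.

Lemma hmap_inj m c : hnear (fun w z => good (m - (size w).-1%:Z) (c w z)) ->
  hnull (hmap phi m c) -> hnull c.
Proof.
move=> cg; apply: hnull_imp; apply: hnearS cg => w z cz hz.
exact: (phi_inj cz hz).
Qed.

(** Lift the primitive [b'] to [b]. With D the total differential, phi (c - D b) = (phi c - D b') +
    D (b' - phi b) is null, and [phi] is injective on the [good] values of c - D b. *)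
Lemma hmap_cobord_inj m c : hcocycle F m c -> hcobord G m (hmap phi m c) ->
  hcobord F m c.
Proof.
move=> [cv _] [b' b'v cb'].
have [b [bv hbv bE]] := hmap_psi_valid b'v; exists b => //.
have cbg : hnear (fun w z => good (m - (size w).-1%:Z) ((c - hdif F (m - 1) b) w z)).
  have cg : hnear (fun w z => good (m - (size w).-1%:Z) (c w z)).
    apply: hnearW => w y; rewrite size_rcons.
    have [U [Uo Uy cU]] := hvalid_near w y cv.
    have : \forall z \near y, U z by exact: open_nbhs_nbhs.
    by apply: filterS => z Uz; exact: (good_sec Uo Uz cU).
  have bg := good_hdif bv; rewrite subrK in bg.
  apply: (hnearS2 _ cg bg) => w z {}cg dg.
  rewrite [X in good _ X](_ : _ = -1 *: hdif F (m - 1) b w z + c w z); last first.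
    by rewrite scaleN1r addrC.
  exact: good_lin.
apply: (hmap_inj cbg).
have ev : hvalid G (m - 1) (b' - hmap phi (m - 1) b).
  exact: hvalidB.
have e0 := hnull_hdif ev bE.
apply: hnull_eq (hnull_lin 1 cb' e0).
have dl : hnear (fun w z => hdif G (m - 1) (b' - hmap phi (m - 1) b) w z =
    hdif G (m - 1) b' w z - hdif G (m - 1) (hmap phi (m - 1) b) w z).
  by apply: hnearW => w y; exact: hdifB.
apply: (hnearS2 _ (hmap_dif_near bv) dl) => w z dE dlE.
rewrite [LHS](_ : _ = 1 *: (hmap phi m c w z - hdif G (m - 1) b' w z) +
  hdif G (m - 1) (b' - hmap phi (m - 1) b) w z) // dlE scale1r addrA subrK dE.
by rewrite subrK hmapB.
Qed.

(** The lift [c] of [d] is a cocycle because phi (D c) = D d - D (d - phi c) is null while D c has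
    [good] values. *)
Lemma hmap_surj m d : hcocycle G m d -> exists2 c, hcocycle F m c &
  hcobord G m (d - hmap phi m c).
Proof.
move=> [dv d0]; have [c [cv hcv cE]] := hmap_psi_valid dv; exists c; last first.
  (* 0 is a primitive, since [d - hmap phi m c] is itself null. *)
  exists 0; first exact: hvalid0.
  apply: (@hnull_eq ((-1) *: hdif G (m - 1) 0 + (d - hmap phi m c))).
    by apply: hnearW => w y; near=> z; rewrite scaleN1r addrC.
  by apply: hnull_lin; [exact: hdif0|exact: hnull_near].
split=> //; apply: (hmap_inj (good_hdif cv)).
have ev : hvalid G m (d - hmap phi m c).
  exact: hvalidB.
have e0 := hnull_hdif ev cE.
apply: hnull_eq (hnull_lin (-1) e0 d0).
have dl : hnear (fun w z => hdif G m (d - hmap phi m c) w z =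
    hdif G m d w z - hdif G m (hmap phi m c) w z).
  by apply: hnearW => w y; exact: hdifB.
apply: (hnearS2 _ (hmap_dif_near cv) dl) => w z dE dlE.
rewrite [LHS](_ : _ = -1 *: hdif G m (d - hmap phi m c) w z + hdif G m d w z) //.
by rewrite dlE -dE scaleN1r opprB subrK.
Unshelve. all: by end_near. Qed.

Lemma hcocycle_typeP (H : sheaf_complex X V) m (c : hcocycle_type H m) :
  hcocycle H m (hcocycle_val c).
Proof. by case: c => /= c cb; exact/asboolP. Qed.

Definition cocycle_map m (c : hcocycle_type F m) : hcocycle_type G m :=
  HCocycle (asboolT (hmap_cocycle (hcocycle_typeP c)) : _ \in hcocycleb G m).

Lemma HH_eq (H : sheaf_complex X V) m (c d : hcocycle_type H m) :
  \pi_(HH H m) c = \pi_(HH H m) d <->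
  hcobord H m (hcocycle_val c - hcocycle_val d).
Proof.
split=> [/eqP|cd]; first by rewrite -Quotient.idealrBE => /asboolP.
by apply/eqP; rewrite -Quotient.idealrBE; apply/asboolP.
Qed.

Definition HH_map m (h : HH F m) : HH G m := \pi_(HH G m) (cocycle_map (repr h)).

Lemma HH_map_pi m (c : hcocycle_type F m) :
  HH_map (\pi_(HH F m) c) = \pi_(HH G m) (cocycle_map c).
Proof.
apply/HH_eq => /=.
rewrite -hmapB.
by apply: hmap_cobord; apply/HH_eq; rewrite reprK.
Qed.

Lemma HH_map_linear m : linear (@HH_map m).
Proof.
move=> a h k; have [c ->] := HH_surj h; have [d ->] := HH_surj k.
rewrite -[a *: _]/(HH_scale a _) HH_scale_pi -HH_piD !HH_map_pi.
rewrite -[a *: _]/(HH_scale a _) HH_scale_pi -HH_piD; congr (\pi_(HH G m) _).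
by apply: val_inj; exact: hmap_lin.
Qed.

HB.instance Definition _ m := GRing.isLinear.Build K (HH F m) (HH G m) *:%R
  (@HH_map m) (@HH_map_linear m).

Lemma HH_map_bij m : bijective (@HH_map m).
Proof.
have inj : injective (@HH_map m).
  move=> h k; have [c ->] := HH_surj h; have [d ->] := HH_surj k.
  rewrite !HH_map_pi => /HH_eq /= cd; apply/HH_eq.
  apply: hmap_cobord_inj; first exact: (hcocycle_typeP (c - d)).
  by rewrite hmapB.
have surj (h : HH G m) : exists k, HH_map k = h.
  have [d ->] := HH_surj h.
  have [c cc dc] := hmap_surj (hcocycle_typeP d).
  exists (\pi_(HH F m) (HCocycle (asboolT cc : _ \in hcocycleb F m))).
  by rewrite HH_map_pi; apply/esym/HH_eq.
exists (fun h => projT1 (cid (surj h))) => [h|h].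
  by apply: inj; case: cid.
by case: cid.
Qed.

(** [m'] will be 2n - (2n - k), which equals [k] without being convertible to it. *)
Lemma HH_map_iso m m' : m' = m ->
  exists Phi : {linear HH F m -> HH G m'}, bijective Phi /\
    forall c h, represents F m c h -> represents G m' (hmap phi m c) (Phi h).
Proof.
move=> ->; exists (@HH_map m); split; first exact: HH_map_bij.
move=> c h [z zc ->]; exists (cocycle_map z); last exact: HH_map_pi.
by rewrite /= zc.
Qed.

End HypercohomologyMap.

(** * Differentials in a chart *)

Section LocalCalculus.
Context {R : realType} {n : nat} {X : cmanifold R n}.
Local Notation C := (cplx R).
Variables (i : chart_index X) (x : X).
Implicit Types (a b c d : 'I_n) (f g : X -> C) (s t I J : seq 'I_n).

Local Opaque pd cplx.

(** Conditional on [dom i x] because [pd] is 0 outside the chart: the rules of calculus then hold at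
    every point. *)
Definition holo_in_chart f := dom i x -> differentiable (f \o unchart i) (chart i x).

Lemma holo_in_chart_cst (k : C) : holo_in_chart (fun=> k).
Proof. by move=> ix; exact: dfb_cst. Qed.

Lemma holo_in_chartM f g : holo_in_chart f -> holo_in_chart g ->
  holo_in_chart (fun y => f y * g y).
Proof. by move=> df dg ix; apply: dfb_mul; [exact: df|exact: dg]. Qed.

Lemma holo_in_chart_sum (T : finType) (F : T -> X -> C) :
  (forall e, holo_in_chart (F e)) -> holo_in_chart (fun y => \sum_e F e y).
Proof. by move=> dF ix; apply: dfb_sum => e; exact: dF. Qed.

Lemma pd_cst a (k : C) : pd i a (fun=> k) x = 0.
Proof.
have [ix|ix] := pselect (dom i x); last exact: pd_out.
by rewrite pdE// derive_cst.
Qed.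

Lemma eq_pd a f g : f =1 g -> pd i a f x = pd i a g x.
Proof. by move=> /funext ->. Qed.

Lemma pdD a f g : holo_in_chart f -> holo_in_chart g ->
  pd i a (fun y => f y + g y) x = pd i a f x + pd i a g x.
Proof.
move=> df dg.
have fgE y : f y + g y = 1 * f y + g y by rewrite mul1r.
by rewrite (pd_lin a df dg fgE) mul1r.
Qed.

Lemma pdZ a (k : C) f : holo_in_chart f -> pd i a (fun y => k * f y) x = k * pd i a f x.
Proof.
move=> df; have fE y : k * f y = k * f y + 0 by rewrite addr0.
by rewrite (pd_lin a df (holo_in_chart_cst 0) fE) pd_cst addr0.
Qed.

Lemma pdN a f : holo_in_chart f -> pd i a (fun y => - f y) x = - pd i a f x.
Proof.
move=> df; rewrite (_ : (fun y => _) = fun y => -1 * f y) ?pdZ ?mulN1r//.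
by apply/funext => y; rewrite mulN1r.
Qed.

Lemma pd_sum a (T : finType) (F : T -> X -> C) : (forall e, holo_in_chart (F e)) ->
  pd i a (fun y => \sum_e F e y) x = \sum_e pd i a (F e) x.
Proof.
move=> dF; elim: (index_enum T) => [|e r IH].
  rewrite big_nil (_ : (fun y => _) = fun=> 0) ?pd_cst//.
  by apply/funext => y; rewrite big_nil.
rewrite (_ : (fun y => _) = fun y => F e y + \sum_(e' <- r) F e' y).
  rewrite pdD ?IH ?big_cons//.
  by move=> ix; apply: dfb_sum => e'; exact: dF.
by apply/funext => y; rewrite big_cons.
Qed.

Lemma pdM a f g : holo_in_chart f -> holo_in_chart g ->
  pd i a (fun y => f y * g y) x = f x * pd i a g x + pd i a f x * g x.
Proof.
move=> df dg; have [ix|ix] := pselect (dom i x); last first.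
  by rewrite !pd_out// mulr0 mul0r addr0.
rewrite !pdE//.
have -> : (fun y => f y * g y) \o unchart i =
  (f \o unchart i) * (g \o unchart i) by [].
rewrite deriveM; [|exact/diff_derivable/df|exact/diff_derivable/dg].
by rewrite /= chartK//; congr (_ + _); exact: mulrC.
Qed.

Lemma extd_cons (w : form X) a s : extd i w (a :: s) x =
  pd i a (w s) x - altsum (fun b t => pd i b (w (a :: t)) x) s.
Proof. exact: (altsum_cons (fun a t => pd i a (w t) x)). Qed.

Lemma extd_cons2 (w : form X) a b s : extd i w [:: a, b & s] x =
  pd i a (w (b :: s)) x - pd i b (w (a :: s)) x +
  altsum (fun c t => pd i c (w [:: a, b & t]) x) s.
Proof. exact: (altsum_cons2 (fun a t => pd i a (w t) x)). Qed.

(** * Lie derivatives of forms of top degree *)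

Section TopForm.
Variables (u : form X).
Hypothesis uA : forall y, antisym (u ^~ y).
Hypothesis un : forall s y, u s y != 0 -> size s = n.
Hypothesis du : forall s, holo_in_chart (u s).

Lemma pd_antisym (w : form X) a : (forall y, antisym (w ^~ y)) ->
  (forall s, holo_in_chart (w s)) -> antisym (fun s => pd i a (w s) x).
Proof.
move=> wA dw s b c t; have /eq_pd -> : w (s ++ [:: b, c & t]) =1
  fun y => - w (s ++ [:: c, b & t]) y by move=> y; exact: wA.
exact: pdN.
Qed.

Lemma pd_size (w : form X) m a s : (forall t y, w t y != 0 -> size t = m) ->
  pd i a (w s) x != 0 -> size s = m.
Proof.
move=> wm; apply: contra_neq_eq => sm.
have /eq_pd -> : w s =1 fun=> 0; last exact: pd_cst.
by move=> y; apply: contra_neq_eq sm => /wm.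
Qed.

Lemma extd_top s : extd i u s x = 0.
Proof.
have uS a t : pd i a (u t) x != 0 -> (size t).+1 = n.+1 by move=> /(pd_size un) ->.
apply/eqP; apply: contraT => us; have := altsum_size uS us => sn.
move: us; rewrite -[extd _ _ _ _]/(altsum (fun a t => pd i a (u t) x) s).
rewrite antisym_big ?eqxx// ?sn//.
by apply: altsum_antisym => a; exact: pd_antisym.
Qed.

(** Only d i_v u remains of Cartan's formula, as du = 0. Its derivatives of [u] give v(u) by du = 0
    evaluated on [c :: s]; its derivatives of [v] give the divergence by dx^d /\ u = 0 evaluated on
    [c :: s]. *)
Lemma lie_top (v : 'I_n -> X -> C) s : (forall c, holo_in_chart (v c)) ->
  lie i v u s x = \sum_c v c x * pd i c (u s) x + (\sum_c pd i c (v c) x) * u s x.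
Proof.
move=> dv; rewrite /lie {1}/vcontr big1 ?add0r; last first.
  by move=> c _; rewrite extd_top mulr0.
rewrite -[LHS]/(altsum (fun a t => pd i a (vcontr v u t) x) s).
rewrite (@eq_altsum _ _ _ (fun a t => \sum_c (v c x * pd i a (u (c :: t)) x +
    \sum_d pd i d (v c) x * ((a == d)%:R * u (c :: t) x)))); last first.
  move=> a t; rewrite /vcontr pd_sum; last by move=> c; exact: holo_in_chartM.
  apply: eq_bigr => c _; rewrite pdM//; congr (_ + _).
  rewrite (bigD1 a)//= eqxx mul1r big1 ?addr0// => d /negPf da.
  by rewrite eq_sym da mul0r mulr0.
rewrite altsum_sum mulr_suml -big_split; apply: eq_bigr => c _ /=.
rewrite altsumD altsumZ altsum_sum; congr (_ * _ + _).
  by apply/eqP; rewrite eq_sym -subr_eq0 -extd_cons extd_top.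
rewrite (bigD1 c)//= big1 ?addr0.
  rewrite altsumZ; congr (_ * _).
  have := altsum_top c (c :: s) (uA x) (fun t => @un t x).
  rewrite (altsum_cons _ c) eqxx mul1r => /eqP; rewrite subr_eq0 => /eqP/esym.
  exact.
move=> d /negPf dc; rewrite altsumZ.
have := altsum_top d (c :: s) (uA x) (fun t => @un t x).
rewrite (altsum_cons _ c) eq_sym dc mul0r sub0r => /eqP; rewrite oppr_eq0 => /eqP ->.
by rewrite mulr0.
Qed.

End TopForm.

Variable P : seq 'I_n -> X -> C.
Hypothesis PA : forall y, antisym (P ^~ y).
Hypothesis dP : forall I, holo_in_chart (P I).

Lemma sharp_dx a : sharp P (dx a) = fun b => P [:: a; b].
Proof.
apply/funext => b; apply/funext => y; rewrite /sharp (bigD1 a)//= big1.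
  by rewrite /dx eqxx mulr1 addr0.
by move=> c /negPf ca; rewrite /dx eqseq_cons ca mulr0.
Qed.

Lemma pairing_dx a b : pairing P (dx a) (dx b) = P [:: a; b].
Proof.
apply/funext => y; rewrite /pairing (bigD1 a)//= [X in _ + X]big1 ?addr0; last first.
  move=> c /negPf ca; rewrite big1// => d _.
  by rewrite /dx eqseq_cons ca mulr0 mul0r.
rewrite (bigD1 b)//= big1 ?addr0; first by rewrite /dx !eqxx !mulr1.
by move=> c /negPf cb; rewrite /dx !eqseq_cons cb mulr0.
Qed.

Lemma extd_fn f c : extd i (fn_form f) [:: c] x = pd i c f x.
Proof. by rewrite /extd big_ord1 expr0 mul1r. Qed.

Lemma lie_dx (v : 'I_n -> X -> C) b c : lie i v (dx b) [:: c] x = pd i c (v b) x.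
Proof.
rewrite /lie {1}/vcontr big1 ?add0r; last first.
  move=> e _; rewrite /extd big1 ?mulr0// => p _.
  by rewrite /dx pd_cst mulr0.
rewrite /extd big_ord1 expr0 mul1r; congr (pd i _ _ x).
apply/funext => y; rewrite /vcontr (bigD1 b)//= big1 ?addr0.
  by rewrite /dx eqxx mulr1.
by move=> e /negPf eb; rewrite /dx eqseq_cons eb mulr0.
Qed.

Lemma bivector_antisym a b y : P [:: a; b] y = - P [:: b; a] y.
Proof. exact: (PA y [::]). Qed.

Lemma pd_bivector_antisym a b c : pd i c (P [:: a; b]) x = - pd i c (P [:: b; a]) x.
Proof. exact: (pd_antisym c PA dP [::] a b [::]). Qed.

(** Each of the two Lie derivatives contributes d P^{ab}, and the last term takes one of them
    away. *)
Lemma cobracket_dx a b c :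
  cobracket P i (dx a) (dx b) [:: c] x = pd i c (P [:: a; b]) x.
Proof.
rewrite /cobracket !sharp_dx !lie_dx pairing_dx extd_fn.
by rewrite (pd_bivector_antisym b a); ring.
Qed.

Lemma nabla_dx a (u : form X) s : nabla P i (dx a) u s x = lie i (sharp P (dx a)) u s x.
Proof.
rewrite /nabla (bigD1 a)//= big1 ?addr0; first by rewrite /dx eqxx mul1r.
by move=> e /negPf ea; rewrite /dx eqseq_cons ea mul0r.
Qed.

(** Derivatives of [w] along letters of [s] occur in both i_pi d and d i_pi and cancel. Two others
    remain, equal by antisymmetry of P, which absorbs the 1/2. *)
Lemma kbdif_local (w : form X) s : (forall t, holo_in_chart (w t)) ->
  kbdif P i w s x = \sum_a \sum_b P [:: a; b] x * pd i a (w (b :: s)) x -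
    2^-1 * altsum (fun d t => \sum_a \sum_b pd i d (P [:: a; b]) x * w [:: a, b & t] x) s.
Proof.
move=> dw; rewrite /kbdif.
have pE (v : form X) t y : picontr P v t y =
    2^-1 * \sum_a \sum_b P [:: a; b] y * v [:: a, b & t] y.
  rewrite /picontr /contr; congr (_ * _).
  rewrite (sum_tuple_cons 1 (fun I => P I y * v (I ++ t) y)); apply: eq_bigr => a _.
  rewrite (sum_tuple_cons 0 (fun I => P (a :: I) y * v (a :: I ++ t) y)).
  apply: eq_bigr => b _.
  by rewrite (sum_tuple0 (fun I => P [:: a, b & I] y * v [:: a, b & I ++ t] y)).
rewrite pE -[extd i (picontr P w) s x]/(altsum (fun d t => pd i d (picontr P w t) x) s).
rewrite (@eq_altsum _ _ _ (fun d t => 2^-1 *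
  (\sum_a \sum_b P [:: a; b] x * pd i d (w [:: a, b & t]) x +
   \sum_a \sum_b pd i d (P [:: a; b]) x * w [:: a, b & t] x))); last first.
  move=> d t; rewrite (_ : picontr P w t =
      fun y => 2^-1 * \sum_a \sum_b P [:: a; b] y * w [:: a, b & t] y).
    have dS a : holo_in_chart (fun y => \sum_b P [:: a; b] y * w [:: a, b & t] y).
      by apply: holo_in_chart_sum => b; exact: holo_in_chartM.
    rewrite pdZ; last exact: holo_in_chart_sum.
    congr (_ * _); rewrite pd_sum//.
    rewrite -big_split; apply: eq_bigr => a _ /=.
    rewrite pd_sum -?big_split; last by move=> b; exact: holo_in_chartM.
    by apply: eq_bigr => b _; rewrite pdM.
  by apply/funext => y; exact: pE.
rewrite altsumZ altsumD mulrDr opprD addrA; congr (_ - _).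
rewrite -mulrBr altsum_sum -sumrB.
have E : \sum_a \sum_b P [:: a; b] x * pd i a (w (b :: s)) x =
    - \sum_a \sum_b P [:: a; b] x * pd i b (w (a :: s)) x.
  apply: (etrans (exchange_big _ _ _ _ _ _)); rewrite -sumrN.
  apply: eq_bigr => a _; rewrite -sumrN; apply: eq_bigr => b _.
  by rewrite bivector_antisym mulNr.
transitivity (2^-1 * (\sum_a \sum_b P [:: a; b] x * pd i a (w (b :: s)) x -
    \sum_a \sum_b P [:: a; b] x * pd i b (w (a :: s)) x)); last first.
  by rewrite -{}E; set Y := \sum_a _; field.
congr (_ * _); rewrite -sumrB; apply: eq_bigr => a _.
rewrite altsum_sum -!sumrB; apply: eq_bigr => b _.
rewrite altsumZ -!mulrBr; congr (_ * _).
by rewrite extd_cons2 addrK.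
Qed.

(** * The intertwining relation in a chart *)

Section Intertwining.
Variables (k : nat) (V : seq 'I_n -> form X).
Hypothesis VA : forall I y, antisym (V I ^~ y).
Hypothesis VA' : forall s y, antisym (fun I => V I s y).
Hypothesis Vkn : forall I s y, V I s y != 0 -> size I = k /\ size s = n.
Hypothesis dV : forall I s, holo_in_chart (V I s).

(** Once [double_altsum] has rewritten the sum over p < q, antisymmetry and degree of [dnabla] can
    be read off from [altsum]. *)
Lemma dnabla_top I s : dnabla P i V I s x =
  altsum (fun a J => \sum_c P [:: a; c] x * pd i c (V J s) x +
    (\sum_c pd i c (P [:: a; c]) x) * V J s x) I +
  2^-1 * altsum (fun b J => altsum (fun a L =>
    \sum_c pd i c (P [:: a; b]) x * V (c :: L) s x) J) I.
Proof.
rewrite /dnabla; congr (_ + _).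
  rewrite /altsum; apply: eq_bigr => p _; congr (_ * _).
  rewrite nabla_dx sharp_dx lie_top//.
  by move=> t y /Vkn[].
rewrite -double_altsum; last first.
  move=> a b L; rewrite -sumrN; apply: eq_bigr => c _.
  by rewrite (pd_bivector_antisym a b) mulNr.
apply: eq_bigr => q _; apply: eq_bigr => p _; congr (_ * _).
by apply: eq_bigr => c _; rewrite cobracket_dx.
Qed.

Lemma dnabla_antisymd I : antisym (fun s => dnabla P i V I s x).
Proof.
move=> s a b t /=; rewrite !dnabla_top opprD -mulrN -!altsumN; congr (_ + _ * _).
  apply: eq_altsum => d J; rewrite opprD -mulrN -sumrN VA; congr (_ + _).
  apply: eq_bigr => c _; rewrite -mulrN; congr (_ * _).
  exact: (pd_antisym c (VA J) (dV J)).
apply: eq_altsum => d J; rewrite -altsumN; apply: eq_altsum => e L.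
by rewrite -sumrN; apply: eq_bigr => c _; rewrite VA mulrN.
Qed.

Lemma dnabla_antisymu s : antisym (fun I => dnabla P i V I s x).
Proof.
have -> : (fun I => dnabla P i V I s x) = fun I =>
    altsum (fun a J => \sum_c P [:: a; c] x * pd i c (V J s) x +
    (\sum_c pd i c (P [:: a; c]) x) * V J s x) I +
  2^-1 * altsum (fun b J => altsum (fun a L =>
    \sum_c pd i c (P [:: a; b]) x * V (c :: L) s x) J) I.
  by apply/funext => I; exact: dnabla_top.
move=> I a b J; rewrite opprD -mulrN; congr (_ + _ * _).
  apply: altsum_antisym => d {I a b}J I a b.
  rewrite opprD -mulrN -sumrN VA'; congr (_ + _).
  apply: eq_bigr => c _; rewrite -mulrN; congr (_ * _).
  exact: (pd_antisym (w := V^~ s) c (VA' s) (dV^~ s)).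
apply: altsum_antisym => d; apply: altsum_antisym => e {I a b}J I a b.
rewrite -sumrN; apply: eq_bigr => c _.
by rewrite -!cat_cons VA' mulrN.
Qed.

Lemma dnabla_size I s : dnabla P i V I s x != 0 -> size I = k.+1 /\ size s = n.
Proof.
have V0 J : ~ (size J = k /\ size s = n) -> V J s = fun=> 0.
  move=> Js; apply/funext => y; apply/eqP; apply: contraT => /Vkn[Jk sn].
  by case: Js.
have term1 a J : \sum_c P [:: a; c] x * pd i c (V J s) x +
    (\sum_c pd i c (P [:: a; c]) x) * V J s x != 0 -> size J = k /\ size s = n.
  apply: contra_neqP => /V0 ->; rewrite mulr0 addr0 big1// => c _.
  by rewrite pd_cst mulr0.
have term2 a b L : \sum_c pd i c (P [:: a; b]) x * V (c :: L) s x != 0 ->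
    (size L).+1 = k /\ size s = n.
  apply: contra_neqP => Ls; rewrite big1// => c _.
  by rewrite (V0 (c :: L)) ?mulr0.
rewrite dnabla_top => dV0.
have : altsum (fun a J => \sum_c P [:: a; c] x * pd i c (V J s) x +
    (\sum_c pd i c (P [:: a; c]) x) * V J s x) I != 0 \/
  altsum (fun b J => altsum (fun a L =>
    \sum_c pd i c (P [:: a; b]) x * V (c :: L) s x) J) I != 0.
  apply/orP; rewrite -negb_and; apply: contraNN dV0 => /andP[/eqP -> /eqP ->].
  by rewrite mulr0 addr0.
have [sn|sn] := eqVneq (size s) n.
  case=> IJ; split=> //; move: IJ; apply: altsum_size => a J.
    by move=> /term1[->].
  by move=> JL; congr _.+1; move: JL; apply: altsum_size => b L /term2[].
case=> /negP[]; apply/eqP; rewrite /altsum big1// => p _;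
  rewrite [X in _ * X](_ : _ = 0) ?mulr0//.
  by apply: contra_neq_eq sn => /term1[].
rewrite big1// => q _; rewrite [X in _ * X](_ : _ = 0) ?mulr0//.
by apply: contra_neq_eq sn => /term2[].
Qed.

Definition contraction : form X := fun s y =>
  (k`!%:R)^-1 * \sum_(J : k.-tuple 'I_n) V J (J ++ s) y.

(** Contraction has constant coefficients in a chart, hence commutes with [pd]; the claim becomes
    [contract_identity] with [B c a b] the derivative of P^{ab} in direction c. *)
Lemma contract_dnabla s :
  (k.+1`!%:R)^-1 * \sum_(I : k.+1.-tuple 'I_n) dnabla P i V I (I ++ s) x =
  (-1) ^+ k.+1 * kbdif P i contraction s x.
Proof.
have dS t : holo_in_chart (fun y => \sum_(J : k.-tuple 'I_n) V J (J ++ t) y).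
  by apply: holo_in_chart_sum => J.
have dw t : holo_in_chart (contraction t) :=
  holo_in_chartM (holo_in_chart_cst _) (dS t).
rewrite (kbdif_local s dw).
have E c t : pd i c (contraction t) x =
    (k`!%:R)^-1 * \sum_(J : k.-tuple 'I_n) pd i c (V J (J ++ t)) x.
  by rewrite pdZ// pd_sum.
have -> : \sum_(I : k.+1.-tuple 'I_n) dnabla P i V I (I ++ s) x =
    \sum_(I : k.+1.-tuple 'I_n)
    (altsum (fun a J => \sum_c P [:: a; c] x * pd i c (V J (I ++ s)) x +
       (\sum_c pd i c (P [:: a; c]) x) * V J (I ++ s) x) I +
     2^-1 * altsum (fun b J => altsum (fun a L =>
       \sum_c pd i c (P [:: a; b]) x * V (c :: L) (I ++ s) x) J) I).
  by apply: eq_bigr => I _; exact: dnabla_top.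
have -> : \sum_a \sum_b P [:: a; b] x * pd i a (contraction (b :: s)) x =
    \sum_a \sum_b P [:: a; b] x * ((k`!%:R)^-1 *
      \sum_(J : k.-tuple 'I_n) pd i a (V J (J ++ b :: s)) x).
  by apply: eq_bigr => a _; apply: eq_bigr => b _; rewrite E.
apply: (@contract_identity R n k (fun a b => P [:: a; b] x)
  (fun c a b => pd i c (P [:: a; b]) x) (fun J t => V J t x)
  (fun c J t => pd i c (V J t) x)).
- by move=> a b; exact: bivector_antisym.
- by move=> c a b; exact: pd_bivector_antisym.
- by move=> J; exact: VA.
- by move=> t; exact: VA'.
- by move=> J t /Vkn[].
- by move=> c J; exact: (pd_antisym c (VA J) (dV J)).
Qed.

End Intertwining.
End LocalCalculus.

(** * Change of coordinates *)

Section Jacobian.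
Local Open Scope classical_set_scope.

Lemma derive_coord (K : numFieldType) (V : normedModType K) m n
    (f : V -> 'M[K]_(m, n)) p v a b : differentiable f p ->
  'D_v (fun u => f u a b) p = 'D_v f p a b.
Proof.
move=> df; have g_lin : linear (fun N : 'M[K]_(m, n) => N a b).
  by move=> k M N; rewrite !mxE.
pose gM := GRing.isLinear.Build _ _ _ _ _ g_lin.
pose g : {linear 'M[K]_(m, n) -> K} := HB.pack (fun N : 'M[K]_(m, n) => N a b) gM.
have gc : continuous g by exact: coord_continuous.
have dg M : differentiable g M by exact: linear_differentiable.
rewrite (_ : (fun u => f u a b) = g \o f) // !deriveE//; last first.
  exact: differentiable_comp.
rewrite diff_comp//; exact: (congr1 (fun h => h ('d f p v)) (diff_lin (f p) gc)).
Qed.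

Lemma diff_left_inverse (K : numFieldType) (V W : normedModType K)
    (f : V -> W) (g : W -> V) p q v : differentiable f p -> differentiable g q ->
  f p = q -> (\forall u \near p, (g \o f) u = u) -> 'd g q ('d f p v) = v.
Proof.
move=> df dg fpq gf; rewrite -fpq in dg *.
have := congr1 (fun h => h v) (diff_comp df dg) => /= <-.
rewrite -deriveE; last exact: differentiable_comp.
by rewrite (near_eq_derive v gf) derive_id.
Qed.

Lemma linear_row_sum (K : comNzRingType) m n (g : {linear 'rV[K]_m -> 'rV[K]_n})
    (v : 'rV[K]_m) c :
  \sum_b v 0 b * g (delta_mx 0 b) 0 c = g v 0 c.
Proof.
rewrite [v in RHS]row_sum_delta linear_sum summxE.
by apply: eq_bigr => b _; rewrite linearZ mxE.
Qed.

Context {R : realType} {n : nat} {X : cmanifold R n}.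
Local Notation C := (cplx R).
Implicit Types (i j : chart_index X) (x : X).
Local Opaque cplx.

Lemma jacE i j x a b : dom i x -> dom j x ->
  jac i j x a b = 'd (chart j \o unchart i) (chart i x) (delta_mx 0 a) 0 b.
Proof.
move=> ix jx; rewrite /jac (pdE a _ ix).
have dji := chart_holo ix jx.
rewrite -deriveE//; exact: (derive_coord (delta_mx 0 a) 0 b dji).
Qed.

Lemma near_chartK i x : dom i x ->
  \forall v \near chart i x, chart i (unchart i v) = v.
Proof.
move=> ix; have : \forall v \near chart i x, (chart i @` dom i) v.
  by apply: open_nbhs_nbhs; split; [exact: chart_open|exists x].
by apply: filterS => v [y iy <-]; rewrite chartK.
Qed.

(** The chain rule for the two transition maps, whose composite is the identity near [chart i x]. *)
Lemma jac_inverse i j x a c : dom i x -> dom j x ->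
  \sum_b jac i j x a b * jac j i x b c = (a == c)%:R.
Proof.
move=> ix jx.
have df := chart_holo ix jx; have dg := chart_holo jx ix.
have fx : (chart j \o unchart i) (chart i x) = chart j x by rewrite /= chartK.
have gf : \forall v \near chart i x,
    ((chart i \o unchart j) \o (chart j \o unchart i)) v = v.
  have jU : \forall v \near chart i x, dom j (unchart i v).
    exact: near_unchart (@dom_open _ _ X j) jx ix.
  by apply: filterS2 (near_chartK ix) jU => v iv jv /=; rewrite chartK.
have := diff_left_inverse (delta_mx 0 a) df dg fx gf.
have jE b := jacE a b ix jx; have jE' b := jacE b c jx ix.
move=> /matrixP/(_ 0 c); rewrite [RHS]mxE eqxx /= eq_sym => <-.
apply: (etrans _ (linear_row_sum _ _ _)); apply: eq_bigr => b _.
exact: (f_equal2 _ (jE b) (jE' b)).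
Qed.

End Jacobian.

(** * Contraction of multivector fields with n-forms *)

Section Contraction.
Local Open Scope classical_set_scope.
Context {R : realType} {n : nat} {X : cmanifold R n}.
Local Notation C := (cplx R).
Local Opaque cplx pd.
Implicit Types (i j : chart_index X) (x : X) (U : set X) (T W : X -> tensor X).
Implicit Types (k : int) (I J s t : seq 'I_n).

Definition signed_tau k T : X -> tensor X := tau_sign k *: tau k T.

(** Outside 0 <= k <= n there are no nonzero sections on either side, and [n - m] would be a
    truncated subtraction. *)
Definition signed_uncontract k W : X -> tensor X := fun x i I s =>
  if k is Posz m then
    if (m <= n)%N then (tau_sign k)^-1 * uncontract (n - m) (W x i [::]) I s else 0
  else 0.

(** The part of [tsection_at k n] that can be checked on a single value; holomorphy and transition
    laws of [lp_dif pi T] are thereby left aside. *)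
Record top_tensor k (v : tensor X) : Prop := TopTensor {
  top_degree : forall i I s, v i I s != 0 -> (size I)%:Z = k /\ size s = n;
  top_antisymu : forall i s, antisym (fun I => v i I s);
  top_antisymd : forall i I, antisym (v i I)
}.

Lemma tau_sign_neq0 k : tau_sign k != 0 :> C.
Proof. by rewrite /tau_sign signr_eq0. Qed.

Lemma tau_signS m : tau_sign m.+1%:Z = tau_sign m%:Z * (-1) ^+ m.+1 :> C.
Proof. by rewrite /tau_sign /= binS bin1 exprD. Qed.

Lemma tauE k T x i s : tau k T x i [::] s =
  ((`|k|%N)`!%:R)^-1 * \sum_(I : `|k|.-tuple 'I_n) T x i I (I ++ s).
Proof. by []. Qed.

Lemma signed_tau_lin k (a : C) T W :
  signed_tau k (a *: T + W) = a *: signed_tau k T + signed_tau k W.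
Proof.
apply/funext => x; apply/funext => i; apply/funext => I; apply/funext => s.
rewrite -[LHS]/(tau_sign k * tau k (a *: T + W) x i I s).
rewrite -[RHS]/(a * (tau_sign k * tau k T x i I s) + tau_sign k * tau k W x i I s).
case: I => [|b I]; last by rewrite !mulr0 addr0.
have E : \sum_(J : `|k|.-tuple 'I_n) (a *: T + W) x i J (J ++ s) =
    a * (\sum_(J : `|k|.-tuple 'I_n) T x i J (J ++ s)) +
    \sum_(J : `|k|.-tuple 'I_n) W x i J (J ++ s).
  by rewrite mulr_sumr -big_split.
rewrite !tauE E !mulrDr; congr (_ + _).
by rewrite [RHS]mulrCA; congr (_ * _); exact: mulrCA.
Qed.

Lemma signed_tau_ker k T x : T x = 0 -> signed_tau k T x = 0.
Proof.
move=> T0; apply/funext => i; apply/funext => I; apply/funext => s.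
rewrite -[LHS]/(tau_sign k * tau k T x i I s).
case: I => [|b I]; last by rewrite mulr0.
by rewrite tauE big1 ?mulr0// => J _; rewrite T0.
Qed.

Lemma signed_tau_inj k T x : top_tensor k (T x) -> signed_tau k T x = 0 -> T x = 0.
Proof.
move=> gT T0; apply/funext => i; apply/funext => I; apply/funext => s.
rewrite -[RHS]/(0 : C); case: k gT T0 => [m|m] gT T0; last first.
  by apply/eqP; apply: contraT => /(top_degree gT)[].
apply: (@contract_inj R n m (T x i)).
- exact: (top_antisymd gT).
- by move=> t; exact: (top_antisymu gT).
- by move=> J t /(top_degree gT)[[-> ->]].
move=> t; have := congr1 (fun v : tensor X => v i [::] t) T0.
rewrite -[LHS]/(tau_sign m%:Z * tau m%:Z T x i [::] t) tauE => /eqP.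
rewrite !mulf_eq0 (negPf (tau_sign_neq0 _)) invr_eq0 pnatr_eq0 /=.
by rewrite -[_ == 0%N]negbK -lt0n fact_gt0 => /eqP.
Qed.

Lemma top_tensor0 k : top_tensor k 0.
Proof.
split; first by move=> i I s /negP[].
  by move=> i s r a b t; rewrite -[RHS]/(- 0) oppr0.
by move=> i s r a b t; rewrite -[RHS]/(- 0) oppr0.
Qed.

Lemma top_tensor_lin k (a : C) (u v : tensor X) :
  top_tensor k u -> top_tensor k v -> top_tensor k (a *: u + v).
Proof.
move=> gu gv; have E i I s : (a *: u + v) i I s = a * u i I s + v i I s by [].
split.
- move=> i I s; rewrite E; have [->|u0 _] := eqVneq (u i I s) 0.
    by rewrite mulr0 add0r; exact: (top_degree gv).
  exact: (top_degree gu u0).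
- move=> i s r b c t; rewrite !E (top_antisymu gu) (top_antisymu gv).
  by rewrite mulrN opprD.
- move=> i s r b c t; rewrite !E (top_antisymd gu) (top_antisymd gv).
  by rewrite mulrN opprD.
Qed.

Lemma tsection_top k T x : tsection_at k n T x -> top_tensor k (T x).
Proof.
case=> dg _ au ad _ _; split=> // i I s /dg[Ik [sn]]; split=> //.
Qed.

Lemma tsection_degree0 k l U T : tsection k l U T ->
  (forall I s, (size I)%:Z = k -> (size s)%:Z = l -> False) ->
  forall x, U x -> T x = 0.
Proof.
move=> TU kl x Ux; apply/funext => i; apply/funext => I; apply/funext => s.
rewrite -[RHS]/(0 : C); apply/eqP; apply: contraT => /(ts_degree (TU x Ux))[Ik sl].
by case: (kl I s).
Qed.

Lemma tsection_zero k l U T : open U -> (forall x, U x -> T x = 0) ->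
  tsection k l U T.
Proof.
move=> Uo T0; have E : {in U, (0 : X -> tensor X) =1 T} by move=> x /set_mem/T0.
exact: (tsection_ext Uo E (@tsection0 _ _ _ k l U)).
Qed.

Lemma tau_section k U T : open U -> tsection k n U T ->
  tsection 0 (n%:Z - k) U (tau k T).
Proof.
move=> Uo TU; case: k TU => m TU; last first.
  apply: tsection_zero => // x Ux.
  have T0 : T x = 0 by apply: (tsection_degree0 TU) => // I s.
  apply/funext => i; apply/funext => -[|a I]; apply/funext => s //.
  by rewrite tauE big1 ?mulr0// => J _; rewrite T0.
move=> x Ux; have Tx := TU x Ux.
have nz i I s : tau m T x i I s != 0 -> I = [::] /\
    exists J : m.-tuple 'I_n, T x i J (J ++ s) != 0.
  case: I => [|a I]; last by rewrite eqxx.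
  move=> Ts; split=> //; apply/existsP; apply: contra_neqT Ts => /existsPn Ts.
  rewrite tauE big1 ?mulr0// => J _; apply/eqP.
  by have := Ts J; rewrite negbK.
split.
- move=> i I s /nz[-> [J /(ts_degree Tx)[_]]]; rewrite size_cat size_tuple PoszD.
  by move=> <-; split=> //; rewrite addrC addKr.
- by move=> i I s /nz[_ [J /(ts_dom Tx)]].
- move=> i s r a b t; rewrite -[LHS]/(tau m T x i _ s) -[X in - X]/(tau m T x i _ s).
  by case: r => [|? ?] /=; rewrite oppr0.
- move=> i [|a I]; last by move=> r b c t; rewrite /= oppr0.
  move=> r a b t; rewrite !tauE -mulrN -sumrN; congr (_ * _).
  apply: eq_bigr => J _; exact: (antisym_catl J (ts_antisymd Tx i J)).
- move=> i [|a I] s ix j jx; last exact: dfb_cst.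
  apply: dfb_mul; first exact: dfb_cst.
  by apply: dfb_sum => J; exact: (ts_holo Tx J (J ++ s) ix jx).
- move=> i j I s ix jx.
  rewrite -[RHS]/(change_frame (jac i j x) (jac j i x) (tau m T x i) I s) change_frameE.
  case: I => [|a I]; last first.
    rewrite -[LHS]/(0 : C) /pull big1// => -[J JP] _ /=.
    by case: J JP => [//|b J] JP; rewrite big1 ?mul0r// => t _; rewrite mul0r.
  rewrite pull_nil tauE.
  have -> : \sum_(J : m.-tuple 'I_n) T x j J (J ++ s) =
      \sum_(J : m.-tuple 'I_n) change_frame (jac i j x) (jac j i x) (T x i) J (J ++ s).
    by apply: eq_bigr => J _; exact: (ts_change Tx J (J ++ s) ix jx).
  rewrite contract_change_frame; last by move=> a c; exact: jac_inverse.
  by rewrite -pullZ.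
Qed.

(** For the transition law, the component in chart [j] and the one transformed from chart [i] have
    the same contraction, namely [W] in chart [j] up to m!, because contraction commutes with change
    of frame; [contract_inj] then identifies them. *)
Lemma uncontract_section m U W : (m <= n)%N -> tsection 0 (n%:Z - m%:Z) U W ->
  tsection m n U (fun x i => uncontract (n - m) (W x i [::])).
Proof.
move=> mn WU x Ux; have Wx := WU x Ux.
have Wn i s : W x i [::] s != 0 -> size s = (n - m)%N.
  by move=> /(ts_degree Wx)[_]; rewrite subzn// => -[->].
have mnn : (m + (n - m))%N = n by rewrite subnKC.
have lm i I s : uncontract (n - m) (W x i [::]) I s != 0 -> size I = m /\ size s = n.
  move=> /uncontract_size[In ->]; split=> //.
  by apply/eqP; rewrite -(eqn_add2r (n - m)) In mnn.
split.
- by move=> i I s /lm[-> ->].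
- move=> i I s; have [//|ix] := pselect (dom i x).
  rewrite /uncontract big1 ?mulr0 ?eqxx// => J _.
  suff -> : W x i [::] J = 0 by rewrite mulr0.
  by apply/eqP; apply: contraT => /(ts_dom Wx).
- by move=> i s; exact: uncontract_antisymu.
- by move=> i I; exact: uncontract_antisymd.
- move=> i I s ix j jx; apply: dfb_mul; first exact: dfb_cst.
  apply: dfb_sum => J; apply: dfb_mul; first exact: dfb_cst.
  exact: (ts_holo Wx [::] J ix jx).
move=> i j I s ix jx.
rewrite -[RHS]/(change_frame (jac i j x) (jac j i x) (uncontract (n - m) (W x i [::])) I s).
apply/eqP; rewrite -subr_eq0; apply/eqP; move: I s.
have cA t := change_frame_antisymu (jac i j x) (jac j i x) t
  (uncontract_antisymu (n - m) (W x i [::])).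
have cA' J := change_frame_antisymd (jac i j x) (jac j i x) J
  (uncontract_antisymd (n - m) (W x i [::])).
apply: (@contract_inj R n m (fun I s => uncontract (n - m) (W x j [::]) I s -
  change_frame (jac i j x) (jac j i x) (uncontract (n - m) (W x i [::])) I s)).
- by move=> J r a b t; rewrite cA' uncontract_antisymd opprD.
- by move=> t r a b J; rewrite /= cA uncontract_antisymu opprD.
- move=> J t; have [->|l0 _] := eqVneq (uncontract (n - m) (W x j [::]) J t) 0;
    last exact: lm l0.
  by rewrite sub0r oppr_eq0; apply: change_frame_size => {}J {}t /lm.
move=> t; rewrite sumrB contract_change_frame; last by move=> a c; exact: jac_inverse.
have lc l r : \sum_(J : m.-tuple 'I_n) uncontract (n - m) (W x l [::]) J (J ++ r) =
    m`!%:R * W x l [::] r.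
  rewrite -(uncontract_contract r mnn (ts_antisymd Wx l [::]) (Wn l)).
  by rewrite mulVKf// pnatr_eq0 -lt0n fact_gt0.
have WE : W x j [::] t = pull (jac j i x) (W x i [::]) t.
  have := change_frameE (jac i j x) (jac j i x) (W x i) [::] t.
  rewrite [RHS](pull_nil _ (fun J => pull (jac j i x) (W x i J) t)) => <-.
  exact: (ts_change Wx [::] t ix jx).
by rewrite lc (eq_pull _ _ (lc i)) pullZ WE subrr.
Qed.

Lemma tsection_scale k l U (a : C) T : tsection k l U T -> tsection k l U (a *: T).
Proof.
move=> TU; rewrite -[a *: T]addr0; exact: tsection_lin TU (@tsection0 _ _ _ k l U).
Qed.

Lemma signed_tau_section k U T : open U -> tsection k n U T ->
  tsection 0 (n%:Z - k) U (signed_tau k T).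
Proof. by move=> Uo TU; apply: tsection_scale; exact: tau_section. Qed.

Lemma signed_uncontract_section k U W : open U -> tsection 0 (n%:Z - k) U W ->
  tsection k n U (signed_uncontract k W).
Proof.
case: k => m Uo WU; last exact: tsection_zero.
have [mn|mn] := leqP m n; last first.
  apply: tsection_zero => // x _; apply/funext => i; apply/funext => I.
  by apply/funext => s; rewrite /signed_uncontract leqNgt mn.
have := tsection_scale (tau_sign m%:Z)^-1 (uncontract_section mn WU).
apply: tsection_ext => // x _; apply/funext => i; apply/funext => I.
by apply/funext => s; rewrite /signed_uncontract mn.
Qed.

Lemma signed_uncontractK k U W x : open U -> U x -> tsection 0 (n%:Z - k) U W ->
  signed_tau k (signed_uncontract k W) x = W x.
Proof.
move=> Uo Ux WU; have Wx := WU x Ux.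
have W0 : (forall i s, W x i [::] s = 0) -> signed_tau k (signed_uncontract k W) x = W x.
  move=> Wx0; have -> : W x = 0.
    apply/funext => i; apply/funext => -[|a I]; apply/funext => s; first exact: Wx0.
    by rewrite -[RHS]/(0 : C); apply/eqP; apply: contraT => /(ts_degree Wx)[].
  apply: signed_tau_ker; apply/funext => i; apply/funext => I; apply/funext => s.
  rewrite /signed_uncontract -[RHS]/(0 : C); case: (k) => // m; case: ifP => // _.
  by rewrite /uncontract big1 ?mulr0// => J _; rewrite Wx0 mulr0.
(* For k < 0 or k > n the degree n - k exceeds n or is negative, so the form is zero and [W0]
   applies. *)
case: k WU Wx W0 => m WU Wx W0; last first.
  apply: W0 => i s; have [//|/(ts_degree Wx)[_ sn]] := eqVneq (W x i [::] s) 0.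
  apply: (antisym_big (ts_antisymd Wx i [::])).
  by rewrite -ltz_nat sn NegzE opprK ltrDl.
have [mn|mn] := leqP m n; last first.
  apply: W0 => i s; apply/eqP; apply: contraT => /(ts_degree Wx)[_ sn].
  by have : (n%:Z - m%:Z < 0) by [rewrite subr_lt0 ltz_nat]; rewrite -sn.
have mnn : (m + (n - m))%N = n by rewrite subnKC.
apply/funext => i; apply/funext => I; apply/funext => s.
case: I => [|a I]; last first.
  rewrite -[LHS]/(tau_sign m%:Z * 0) mulr0; apply/esym/eqP.
  by apply: contraT => /(ts_degree Wx)[].
rewrite -[LHS]/(tau_sign m%:Z * tau m%:Z (signed_uncontract m%:Z W) x i [::] s) tauE.
have Wn t : W x i [::] t != 0 -> size t = (n - m)%N.
  by move=> /(ts_degree Wx)[_]; rewrite subzn// => -[->].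
rewrite -[RHS](uncontract_contract s mnn (ts_antisymd Wx i [::]) Wn).
rewrite (eq_bigr (fun J : m.-tuple 'I_n => (tau_sign m%:Z)^-1 *
  uncontract (n - m) (W x i [::]) J (J ++ s))); last first.
  by move=> J _; rewrite /signed_uncontract mn.
by rewrite -mulr_sumr mulrCA mulVKf// tau_sign_neq0.
Qed.

Variable pi : poisson X.

Lemma lp_dif0 x : lp_dif pi 0 x = 0.
Proof. exact: (sheaf_dif0 (lp_complex pi) 0 x). Qed.

Lemma kb_dif0 x : kb_dif pi 0 x = 0.
Proof. exact: (sheaf_dif0 (kb_complex pi) 0 x). Qed.

Section LocalDifferential.
Variables (m : nat) (U : set X) (T : X -> tensor X) (x : X).
Hypotheses (Uo : open U) (Ux : U x) (TU : tsection m n U T).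

(* Cutting T off outside U makes its algebraic properties hold on all of X. *)
Definition cutoff : X -> tensor X := fun y => if y \in U then T y else 0.

Lemma cutoffE : {in U, T =1 cutoff}.
Proof. by move=> y yU; rewrite /cutoff yU. Qed.

Lemma cutoff_top y : top_tensor m%:Z (cutoff y).
Proof.
rewrite /cutoff; case: ifP => [/set_mem yU|_]; last exact: top_tensor0.
exact: tsection_top (TU yU).
Qed.

Let P i : seq 'I_n -> X -> C := fun I => comp (bivector pi) i I [::].

Lemma bivector_holo i I : holo_in_chart i x (P i I).
Proof.
by move=> ix; exact: (tsection_dfb I [::] (@bivector_section _ _ _ pi x Logic.I) ix).
Qed.

Lemma bivector_antisymu i y : antisym (P i ^~ y).
Proof. exact: (ts_antisymu (@bivector_section _ _ _ pi y Logic.I) i [::]). Qed.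

Lemma cutoff_holo i I s : holo_in_chart i x (comp cutoff i I s).
Proof.
move=> ix; apply: (dfb_loc Uo Ux ix _ (tsection_dfb I s (TU Ux) ix)) => y yU.
by rewrite /comp cutoffE.
Qed.

Lemma lp_dif_top_nat : top_tensor m.+1%:Z (lp_dif pi T x).
Proof.
rewrite (lp_dif_loc pi Uo cutoffE (mem_set Ux)).
have VA i I y : antisym (comp cutoff i I ^~ y) := top_antisymd (cutoff_top y) i I.
have VA' i s y : antisym (fun I => comp cutoff i I s y) := top_antisymu (cutoff_top y) i s.
have Vn i I s y : comp cutoff i I s y != 0 -> size I = m /\ size s = n.
  by move=> /(top_degree (cutoff_top y))[[-> ->]].
split=> i.
- by move=> I s /(dnabla_size (@bivector_antisymu i) (@bivector_holo i)
    (VA i) (Vn i) (@cutoff_holo i)) [-> ->].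
- move=> s; exact: (dnabla_antisymu (@bivector_antisymu i) (@bivector_holo i)
    (VA i) (VA' i) (Vn i) (@cutoff_holo i)).
- move=> I; exact: (dnabla_antisymd (@bivector_antisymu i) (@bivector_holo i)
    (VA i) (Vn i) (@cutoff_holo i)).
Qed.

Lemma tau_dif i s : tau m.+1%:Z (lp_dif pi T) x i [::] s =
  (-1) ^+ m.+1 * kb_dif pi (tau m%:Z T) x i [::] s.
Proof.
have tE : {in U, tau m%:Z T =1 tau m%:Z cutoff}.
  move=> y yU; apply/funext => i'; apply/funext => -[|a I]; apply/funext => t //.
  by rewrite !tauE cutoffE.
rewrite (kb_dif_loc pi Uo tE (mem_set Ux)).
have VA I y : antisym (comp cutoff i I ^~ y) := top_antisymd (cutoff_top y) i I.
have VA' t y : antisym (fun I => comp cutoff i I t y) := top_antisymu (cutoff_top y) i t.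
have Vn I t y : comp cutoff i I t y != 0 -> size I = m /\ size t = n.
  by move=> /(top_degree (cutoff_top y))[[-> ->]].
have <- := contract_dnabla (@bivector_antisymu i) (@bivector_holo i)
  VA VA' Vn (@cutoff_holo i) s.
rewrite tauE; congr (_ * _); apply: eq_bigr => I _.
by rewrite (lp_dif_loc pi Uo cutoffE (mem_set Ux)).
Qed.

End LocalDifferential.

(** The sign (-1)^(m+1) of [tau_dif] meets the same factor from [tau_signS] and squares to 1. In
    negative degrees sections vanish, no word having negative size. *)
Lemma signed_tau_dif k U T x : open U -> U x -> tsection k n U T ->
  signed_tau (k + 1) (lp_dif pi T) x = kb_dif pi (signed_tau k T) x.
Proof.
move=> Uo Ux TU; case: k TU => m TU; last first.
  have T0 : {in U, T =1 0}.
    by move=> y /set_mem; apply: (tsection_degree0 TU) => // I s.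
  have tT0 : {in U, signed_tau (Negz m) T =1 0}.
    by move=> y /T0; exact: signed_tau_ker.
  rewrite (kb_dif_loc pi Uo tT0 (mem_set Ux)) kb_dif0.
  apply: signed_tau_ker; rewrite (lp_dif_loc pi Uo T0 (mem_set Ux)).
  exact: lp_dif0.
rewrite (_ : m%:Z + 1 = m.+1%:Z); last by rewrite intS addrC.
have tU := tau_section Uo TU.
have E : kb_dif pi (signed_tau m%:Z T) x =
    (tau_sign m%:Z *: kb_dif pi (tau m%:Z T) + kb_dif pi 0) x.
  rewrite /signed_tau -[_ *: tau _ _]addr0.
  exact: (kb_dif_lin pi (tau_sign m%:Z) Uo tU
    (@tsection0 _ _ _ 0 (n%:Z - m%:Z) U) (mem_set Ux)).
rewrite E; apply/funext => i; apply/funext => I; apply/funext => s.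
rewrite -[LHS]/(tau_sign m.+1%:Z * tau m.+1%:Z (lp_dif pi T) x i I s).
rewrite -[RHS]/(tau_sign m%:Z * kb_dif pi (tau m%:Z T) x i I s + kb_dif pi 0 x i I s).
rewrite (kb_dif0 x) -[X in _ = _ + X]/(0 : C) addr0.
case: I => [|a I]; last by rewrite /kb_dif !mulr0.
rewrite (tau_dif Uo Ux TU) tau_signS -!mulrA; congr (_ * _).
exact: signrMK.
Qed.

Lemma lp_dif_top k U T x : open U -> U x -> tsection k n U T ->
  top_tensor (k + 1) (lp_dif pi T x).
Proof.
move=> Uo Ux TU; case: k TU => m TU; last first.
  have T0 : {in U, T =1 0}.
    by move=> y /set_mem; apply: (tsection_degree0 TU) => // I s.
  rewrite (lp_dif_loc pi Uo T0 (mem_set Ux)) lp_dif0.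
  exact: top_tensor0.
rewrite (_ : m%:Z + 1 = m.+1%:Z); last by rewrite intS addrC.
exact: lp_dif_top_nat Uo Ux TU.
Qed.

End Contraction.

Theorem theorem4p4 (R : realType) (n : nat) (X : cmanifold R n)
    (pi : poisson X) (k : int) :
  exists Phi : {linear lp_cohomology pi k -> kb_homology pi ((2 * n)%:Z - k)},
    bijective Phi /\
    forall (c : hcochain X (tensor X)) (h : lp_cohomology pi k),
      represents (lp_complex pi) k c h ->
      represents (kb_complex pi) ((2 * n)%:Z - ((2 * n)%:Z - k))
        (tau_hcochain k c) (Phi h).
Proof.
(* [hmap signed_tau k] is convertible to [tau_hcochain k], so the map obtained is the one induced by
   the signed contraction. *)
apply: (@HH_map_iso _ _ _ (lp_complex pi) (kb_complex pi)
  signed_tau signed_uncontract top_tensor).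
- exact: signed_tau_lin.
- exact: signed_tau_ker.
- exact: signed_tau_section.
- by move=> q U f x Uo Ux fU; exact: signed_tau_dif Uo Ux fU.
- exact: signed_uncontract_section.
- exact: signed_uncontractK.
- exact: top_tensor0.
- exact: top_tensor_lin.
- by move=> q U f x _ Ux fU; exact: tsection_top (fU x Ux).
- exact: lp_dif_top.
- exact: signed_tau_inj.
- by rewrite subKr.
Qed.
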